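(* Let $\sigma>0$, $\rho>0$, $\alpha>0$, $m=\lceil\alpha\rceil$, $K>0$, $h^*>0$, $b_0,\dots,b_{m-1}\in\mathbb{R}$, and $$ H=\Big\{(t,y)\in\mathbb{R}^2: 0\le t\le h^*,\ \Big|y-e^{-\sigma t^\rho}\sum_{k=0}^{m-1}\frac{b_k}{\Gamma(k+1)}t^{\rho k}\Big|\le K\Big\}. $$ Let $f:H\to\mathbb{R}$ be continuous, bounded, and Lipschitz in the second variable (i.e. for some $L>0$, $|f(t,y)-f(t,\tilde y)|\le L|y-\tilde y|$ for all $(t,y),(t,\tilde y)\in H$), and let $\tilde f:H\to\mathbb{R}$ satisfy the same conditions (continuous, bounded, Lipschitz in the second variable with some constant). Let $\psi$ be the solution of $$ {}_\sigma^c D_0^{\alpha,\rho}\psi(t)=f(t,\psi(t))\ (t>0),\qquad {}_\sigma D^{k,\rho}\psi(0)=b_k,\quad k\in\{0,\dots,m-1\}, $$ and let $\phi$ be the solution of $$ {}_\sigma^c D_0^{\alpha,\rho}\phi(t)=\tilde f(t,\phi(t))\ (t>0),\qquad {}_\sigma D^{k,\rho}\phi(0)=b_k,\quad k\in\{0,\dots,m-1\}. $$ Let $\epsilon=\max_{(t,y)\in H}|f(t,y)-\tilde f(t,y)|$. If $\epsilon$ is sufficiently small, then there is a constant $h>0$ such that $\psi$ and $\phi$ are defined on $[0,h]$ and $$ \sup_{0\le t\le h}|\psi(t)-\phi(t)|=\mathcal{O}(\epsilon). $$ That is, there are constants $\epsilon_0,h,C>0$, not depending on $\tilde f$, such that whenever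 $\epsilon\le\epsilon_0$ both solutions are defined on $[0,h]$ and $\sup_{0\le t\le h}|\psi(t)-\phi(t)|\le C\epsilon$.
   Context: Differential operator: ${}_\sigma D^{n,\rho}=\big(\frac{t^{1-\rho}}{\rho}\frac{d}{dt}+\sigma\big)^n$ ($n$-fold composition, ${}_\sigma D^{0,\rho}$ the identity); ${}_\sigma D^{k,\rho}\psi(0)$ denotes its value at $0$, understood as the limit as $t\to0^+$. Generalized substantial operators with lower limit $0$: for $\gamma>0$, ${}_\sigma I_0^{\gamma,\rho}\psi(t)=\frac{\rho}{\Gamma(\gamma)}\int_0^t (t^\rho-s^\rho)^{\gamma-1}e^{-\sigma(t^\rho-s^\rho)}s^{\rho-1}\psi(s)\,ds$, ${}_\sigma I_0^{0,\rho}$ is the identity, and for $m-1<\alpha\le m$, ${}_\sigma D_0^{\alpha,\rho}\psi={}_\sigma D^{m,\rho}\,{}_\sigma I_0^{m-\alpha,\rho}\psi$. The generalized Caputo type substantial derivative is $$ {}_\sigma^c D_0^{\alpha,\rho}\psi(t)={}_\sigma D_0^{\alpha,\rho}\Big(\psi(t)-\sum_{k=0}^{m-1}\frac{{}_\sigma D^{k,\rho}\psi(0)}{k!}\,t^{\rho k}e^{-\sigma t^\rho}\Big). $$ A solution of such an initial value problem on $[0,h]$ is a function in $C[0,h]$ with graph contained in $H$, for which the expressions in the problem exist, satisfying the differential equation for $0<t\le h$ and the initial conditions; ''the solution is defined on $[0,h]$'' means that a unique such solution on $[0,h]$ exists. *)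

(* Defs.v *)
From HB Require Import structures.
From mathcomp Require Import all_boot all_order all_algebra.
From mathcomp Require Import all_classical all_reals all_analysis.

(* Functions on an interval are represented by total functions [R -> R]; the
   notions below relative to [D = `]0, h]] depend only on their values on D. *)

Set Implicit Arguments.
Unset Strict Implicit.
Unset Printing Implicit Defensive.

Import Order.TTheory GRing.Theory Num.Theory.
Import numFieldNormedType.Exports.

Local Open Scope classical_set_scope.
Local Open Scope ring_scope.

Definition Gamma {R : realType} (a : R) : R :=
  \int[lebesgue_measure]_(x in `]0, +oo[) (x `^ (a - 1) * expR (- x)).

(* Derivative relative to a set D: one-sided at an endpoint of an interval D,
   two-sided in its interior.  [derive_within] is a junk value when
   [derivable_within] fails. *)
Definition derivable_within {R : realType} (D : set R) (g : R -> R) (t : R)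
    : Prop :=
  cvg ((g s - g t) / (s - t) @[s --> within D t^']).

Definition derive_within {R : realType} (D : set R) (g : R -> R) (t : R) : R :=
  lim ((g s - g t) / (s - t) @[s --> within D t^']).

Definition substD1 {R : realType} (D : set R) (sigma rho : R) (g : R -> R)
    (t : R) : R :=
  t `^ (1 - rho) / rho * derive_within D g t + sigma * g t.

Definition substD {R : realType} (D : set R) (sigma rho : R) (n : nat)
    (g : R -> R) : R -> R :=
  iter n (substD1 D sigma rho) g.

(* All derivatives occurring in the n-fold composition exist at t.  This says
   that [substD D sigma rho n g] is meaningful when required for all t in D
   (or in D near an endpoint), since the intermediate functions are then
   defined there. *)
Definition substD_exists {R : realType} (D : set R) (sigma rho : R) (n : nat)
    (g : R -> R) (t : R) : Prop :=
  forall j : nat, (j < n)%N -> derivable_within D (substD D sigma rho j g) t.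

Definition substD_at0 {R : realType} (D : set R) (sigma rho : R) (n : nat)
    (g : R -> R) : R :=
  lim (substD D sigma rho n g t @[t --> 0^'+]).

Definition substD_at0_exists {R : realType} (D : set R) (sigma rho : R)
    (n : nat) (g : R -> R) : Prop :=
  (\forall t \near 0^'+, substD_exists D sigma rho n g t) /\
  cvg (substD D sigma rho n g t @[t --> 0^'+]).

Definition substI_integrand {R : realType} (sigma rho gamma : R) (g : R -> R)
    (t s : R) : R :=
  (t `^ rho - s `^ rho) `^ (gamma - 1) *
  expR (- sigma * (t `^ rho - s `^ rho)) * s `^ (rho - 1) * g s.

Definition substI {R : realType} (sigma rho gamma : R) (g : R -> R) (t : R)
    : R :=
  if gamma == 0 then g t
  else rho / Gamma gamma *
       \int[lebesgue_measure]_(s in `[0, t]) substI_integrand sigma rho gamma g t s.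

Definition substI_exists {R : realType} (sigma rho gamma : R) (g : R -> R)
    (t : R) : Prop :=
  gamma = 0 \/
  lebesgue_measure.-integrable `[0, t]
    (EFin \o substI_integrand sigma rho gamma g t).

(* The parameter m of the fractional operators is the integer with
   m - 1 < alpha <= m. *)
Definition substDfrac {R : realType} (D : set R) (sigma rho alpha : R)
    (m : nat) (g : R -> R) : R -> R :=
  substD D sigma rho m (substI sigma rho (m%:R - alpha) g).

(* g minus its initial-value polynomial: the argument of the fractional
   derivative in the Caputo type operator. *)
Definition caputo_arg {R : realType} (D : set R) (sigma rho : R) (m : nat)
    (g : R -> R) (t : R) : R :=
  g t - \sum_(k < m) substD_at0 D sigma rho k g / (k`!)%:R *
                     t `^ (rho * k%:R) * expR (- sigma * t `^ rho).

Definition caputoD {R : realType} (D : set R) (sigma rho alpha : R) (m : nat)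
    (g : R -> R) : R -> R :=
  substDfrac D sigma rho alpha m (caputo_arg D sigma rho m g).

(* Existence, on all of D, of every expression entering [caputoD]. *)
Definition caputoD_exists {R : realType} (D : set R) (sigma rho alpha : R)
    (m : nat) (g : R -> R) : Prop :=
  [/\ forall k : nat, (k < m)%N -> substD_at0_exists D sigma rho k g,
      forall t, D t ->
        substI_exists sigma rho (m%:R - alpha) (caputo_arg D sigma rho m g) t
    & forall t, D t ->
        substD_exists D sigma rho m
          (substI sigma rho (m%:R - alpha) (caputo_arg D sigma rho m g)) t].

Definition tube {R : realType} (sigma rho hstar K : R) (m : nat)
    (b : 'I_m -> R) : set (R * R) :=
  [set p | 0 <= p.1 <= hstar /\
           `|p.2 - expR (- sigma * p.1 `^ rho) *
             \sum_(k < m) b k / Gamma (k.+1%:R) * p.1 `^ (rho * k%:R)| <= K].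

Definition admissible {R : realType} (H : set (R * R)) (f : R * R -> R)
    : Prop :=
  [/\ {within H, continuous f},
      [bounded f p | p in H]
    & exists2 L : R, 0 < L &
        forall t y z : R, H (t, y) -> H (t, z) ->
          `|f (t, y) - f (t, z)| <= L * `|y - z| ].

Definition solution_on {R : realType} (sigma rho alpha : R) (m : nat)
    (b : 'I_m -> R) (H : set (R * R)) (f : R * R -> R) (h : R) (psi : R -> R)
    : Prop :=
  [/\ {within `[0, h], continuous psi},
      forall t, 0 <= t <= h -> H (t, psi t),
      caputoD_exists `]0, h] sigma rho alpha m psi,
      forall t, 0 < t <= h ->
        caputoD `]0, h] sigma rho alpha m psi t = f (t, psi t)
    & forall k : 'I_m, substD_at0 `]0, h] sigma rho k psi = b k].

Definition unique_solution_on {R : realType} (sigma rho alpha : R) (m : nat)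
    (b : 'I_m -> R) (H : set (R * R)) (f : R * R -> R) (h : R) (psi : R -> R)
    : Prop :=
  solution_on sigma rho alpha b H f h psi /\
  forall chi : R -> R, solution_on sigma rho alpha b H f h chi ->
    forall t, 0 <= t <= h -> chi t = psi t.

Definition is_max {R : realType} (A : set R) (x : R) : Prop :=
  A x /\ ubound A x.

(* Main.v *)
Require Import Defs.
From HB Require Import structures.
From mathcomp Require Import all_boot all_order all_algebra.
From mathcomp Require Import all_classical all_reals all_analysis.
From mathcomp Require Import measurable_realfun lra ring.

Set Implicit Arguments.
Unset Strict Implicit.
Unset Printing Implicit Defensive.

Import Order.TTheory GRing.Theory Num.Theory.
Import numFieldNormedType.Exports.

Local Open Scope classical_set_scope.
Local Open Scope ring_scope.

(** In the variable u = t^rho, and after multiplication by e^(sigma u), the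
    problem becomes a classical one.  If psi(t) = e^(-sigma t^rho) y(t^rho),
    then [substD1] acts on psi as d/du on y, and [substI] of order gamma as the
    Riemann-Liouville integral ([substD1_pull], [is_derive_push],
    [substI_pull]).  Write m = n + 1, gamma = m - alpha, so 0 <= gamma < 1, let
    T be the polynomial sum_k (b_k / k!) u^k and let F y be the right-hand side
    transported to u ([superpos]).  The problem reads

      (I^gamma (y - T))^(m) = F y,   y^(k) (0) = b_k  for k < m,

    and it is equivalent to the Volterra equation y = T + I^alpha (F y).

    The operator I^alpha is built as c times n ordinary integrations of the
    Riemann-Liouville integral of order 1 - gamma, which lies in ]0, 1].  The
    semigroup law I^a I^b = I^(a+b), obtained from Tonelli and a Beta integral
    ([RL_semigroup]), gives I^gamma I^alpha = I^m ([fracI_volterra]), hence a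
    fixed point yields a solution ([solution_on_of_fixpoint]).

    The converse, [fixpoint_of_solution_on], needs care: the m-th derivative of
    I^gamma (y - T) - I^m (F y) vanishes on the open interval, so this function
    is a polynomial p of degree at most n, and it remains to see p = 0.  The
    initial conditions give, by repeated use of the mean value theorem,
    y - T = o(u^n) at 0, thus I^gamma (y - T) = o(u^n), while I^m (F y) is
    O(u^m).  A polynomial of degree at most n that is o(u^n) is zero.
    Injectivity of I^gamma ([RL_inj]) then gives y - T = I^alpha (F y).

    For the sup norm weighted by e^(-lambda u) the operator I^alpha has
    arbitrarily small norm on [0, U] when lambda is large
    ([normr_volterra_expR]).  This gives existence by successive approximations
    ([volterra_fixpoint]), as well as uniqueness and linear dependence on a
    perturbation of the right-hand side ([volterra_stability]).

    The length h only has to guarantee that the iteration does not leave the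
    tube, for which a bound of the right-hand side is enough.  If M bounds f and
    eps <= 1, then M + 1 bounds ftilde, so one h serves for all ftilde; and the
    stability constant uses a Lipschitz constant of f alone. *)

(** * Change of variables on an open interval *)

Lemma near_of_itvoo {R : realType} (a b : R) (P : R -> Prop) :
  (forall x, x \in `]a, b[ -> P x) ->
  forall x, x \in `]a, b[ -> \forall y \near x, P y.
Proof.
move=> H x xab; near=> y; apply: H; near: y.
exact: near_in_itvoo.
Unshelve. all: by end_near. Qed.

(** The derivative q may blow up at an endpoint, as for a power with exponent
    below 1, and G may be singular there too.  Hence substitution is applied on
    a sequence of compact intervals exhausting ]a, b[ and one passes to the limit
    by monotone convergence. *)
Lemma ge0_integral_subst_oo {R : realType} (p q G : R -> R) (a b : R) :
  a < b ->
  {within `[a, b], continuous p} ->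
  (forall x, x \in `]a, b[ -> is_derive x 1 p (q x)) ->
  (forall x, x \in `]a, b[ -> {for x, continuous q}) ->
  (forall x, x \in `]a, b[ -> 0 < q x) ->
  (forall y, y \in `]p a, p b[ -> {for y, continuous G}) ->
  (forall y, y \in `]p a, p b[ -> 0 <= G y) ->
  (\int[lebesgue_measure]_(y in `]p a, p b[) (G y)%:E =
   \int[lebesgue_measure]_(x in `]a, b[) (G (p x) * q x)%:E)%E.
Proof.
move=> ab cp dp cq q0 cG G0.
have pE x : x \in `]a, b[ -> derive1 p x = q x.
  by move=> xab; rewrite derive1E; case: (dp _ xab).
have cp' x : x \in `]a, b[ -> {for x, continuous (derive1 p)}.
  move=> xab; rewrite /prop_for /continuous_at pE//.
  apply: cvg_trans (cq x xab); apply: near_eq_cvg.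
  by apply: (near_of_itvoo _ xab) => y yab; rewrite pE.
have incp : {in `[a, b] &, {homo p : x y / x < y}}.
  apply: gtr0_derive1_lt_cc cp => x xab; last by rewrite pE// q0.
  by have := dp _ xab.
have pin x : x \in `]a, b[ -> p x \in `]p a, p b[.
  rewrite !in_itv/= => /andP[ax xb].
  by apply/andP; split; apply: incp => //; rewrite in_itv/= ?lexx ?ltW.
pose e n : R := (b - a) / n.+3%:R.
have e0 n : 0 < e n by rewrite divr_gt0 ?subr_gt0.
have e2 n : e n * 2 < b - a.
  rewrite /e mulrAC ltr_pdivrMr ?ltr0n// ltr_pM2l ?subr_gt0//.
  by rewrite ltr_nat.
have en m n : (m <= n)%N -> e n <= e m.
  move=> mn; rewrite ler_wpM2l ?subr_ge0 ?(ltW ab)//.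
  by rewrite lef_pV2 ?posrE ?ltr0n// ler_nat.
have ecvg x : 0 < x -> exists n, e n < x.
  move=> x0; exists (Num.truncn ((b - a) / x)).
  rewrite /e ltr_pdivrMr ?ltr0n// mulrC -ltr_pdivrMr//.
  rewrite (lt_trans (truncnS_gt _))// ltr_nat.
  by rewrite !ltnS.
pose A n := a + e n; pose B n := b - e n.
have AB n : [/\ a < A n, A n < B n & B n < b].
  by have := e0 n; have := e2 n; rewrite /A /B; split; lra.
have Aab n x : x \in `[A n, B n] -> x \in `]a, b[.
  by have [? ? ?] := AB n; rewrite !in_itv/= => /andP[? ?]; apply/andP; split; lra.
have AA n : A n \in `]a, b[ by apply: (@Aab n); rewrite in_itv/= lexx; have [_ /ltW-> _] := AB n.
have BB n : B n \in `]a, b[ by apply: (@Aab n); rewrite in_itv/= lexx; have [_ /ltW-> _] := AB n.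
have hi u v : u \in `]a, b[ -> v \in `]a, b[ -> u <= v -> p u <= p v.
  move=> ua va; rewrite le_eqVlt => /predU1P[->//|uv].
  by apply/ltW/incp => //; exact: subset_itv_oo_cc.
have cpA x : x \in `]a, b[ -> {for x, continuous p}.
  move=> xab; apply: differentiable_continuous; apply/derivable1_diffP.
  by have := dp _ xab.
have sub n : (\int[lebesgue_measure]_(y in `[p (A n), p (B n)]) (G y)%:E =
   \int[lebesgue_measure]_(x in `[A n, B n]) (G (p x) * q x)%:E)%E.
  have [aA /ltW leAB Bb] := AB n.
  rewrite integration_by_substitution_increasing//.
  - by apply: eq_integral => x; rewrite inE/= => /Aab xab; rewrite !fctE/= pE.
  - move=> x y xn yn; apply: incp; apply: subset_itv_oo_cc; [exact: Aab xn|exact: Aab yn].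
  - by move=> x xn; apply: cp'; apply: (@Aab n); apply: subset_itv_oo_cc xn.
  - by apply/cvg_ex; exists (derive1 p (A n)); apply/cvg_at_right_filter/cp'.
  - by apply/cvg_ex; exists (derive1 p (B n)); apply/cvg_at_left_filter/cp'.
  - split.
    + by move=> x /subset_itv_oo_cc/Aab/dp [].
    + exact/cvg_at_right_filter/cpA.
    + exact/cvg_at_left_filter/cpA.
  - apply: continuous_in_subspaceT => y; rewrite inE/= in_itv/= => /andP[py1 py2].
    apply: cG; rewrite in_itv/=.
    have := pin _ (AA n); rewrite in_itv/= => /andP[h1 _].
    have := pin _ (BB n); rewrite in_itv/= => /andP[_ h2].
    by rewrite (lt_le_trans h1 py1) (le_lt_trans py2 h2).
have bigx : \bigcup_n `[A n, B n]%classic = `]a, b[%classic.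
  apply/seteqP; split => [x [n _]|x] /=; first exact: Aab.
  rewrite in_itv/= => /andP[ax xb].
  have [n1 h1] := ecvg (x - a) ltac:(by rewrite subr_gt0).
  have [n2 h2] := ecvg (b - x) ltac:(by rewrite subr_gt0).
  exists (maxn n1 n2) => //=; rewrite in_itv/= /A /B.
  have := en _ _ (leq_maxl n1 n2); have := en _ _ (leq_maxr n1 n2).
  by move=> ? ?; apply/andP; split; lra.
have bigy : \bigcup_n `[p (A n), p (B n)]%classic = `]p a, p b[%classic.
  apply/seteqP; split => [y [n _]|y] /=.
    have := pin _ (AA n); have := pin _ (BB n).
    rewrite !in_itv/= => /andP[? ?] /andP[? ?] /andP[? ?]; apply/andP; split; lra.
  move=> /[dup] yab; rewrite in_itv/= => /andP[ay yb].
  have [|x] := @IVT _ p a b y (ltW ab) cp.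
    by rewrite min_l ?max_r ?ltW ?ay ?yb// (lt_trans ay).
  rewrite in_itv/= => /andP[ax xb] pxy.
  have xab : x \in `]a, b[%classic.
    rewrite inE/= in_itv/= !lt_neqAle ax xb !andbT; apply/andP; split.
      by apply/eqP => ax'; move: ay; rewrite -pxy ax' ltxx.
    by apply/eqP => ax'; move: yb; rewrite -pxy ax' ltxx.
  move: xab; rewrite -bigx inE => -[n _ /= xn].
  exists n => //=; have xab := Aab _ _ xn.
  rewrite -pxy; move: xn; rewrite !in_itv/= => /andP[Ax xB].
  by rewrite !hi.
have mono n m : (n <= m)%N -> p (A m) <= p (A n) /\ p (B n) <= p (B m).
  move=> nm; have := en _ _ nm; rewrite /A /B => h.
  by split; apply: hi; rewrite ?AA ?BB//; lra.
have limy : ((\int[lebesgue_measure]_(y in `[p (A n), p (B n)]) (G y)%:E) @[n --> \oo] -->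
  \int[lebesgue_measure]_(y in \bigcup_n `[p (A n), p (B n)]%classic) (G y)%:E)%E.
  apply: ge0_nondecreasing_set_cvg_integral.
  - move=> n m nm; rewrite subsetEset => y /=; rewrite !in_itv/=.
  by have [? ?] := mono _ _ nm; move=> /andP[? ?]; apply/andP; split; lra.
  - by move=> n; exact: measurable_itv.
  - move=> n; apply: (@measurable_funS _ _ _ _ `]p a, p b[) => //.
    by rewrite -bigy => y yn; exists n.
    apply/measurable_EFinP; apply: open_continuous_measurable_fun => //.
  by move=> y; rewrite inE; exact: cG.
  - move=> n y yn; rewrite lee_fin G0//.
    suff : `]p a, p b[%classic y by [].
    by rewrite -bigy; exists n.
have limx : ((\int[lebesgue_measure]_(y in `[p (A n), p (B n)]) (G y)%:E) @[n --> \oo] -->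
  \int[lebesgue_measure]_(x in \bigcup_n `[A n, B n]%classic) (G (p x) * q x)%:E)%E.
under eq_fun do rewrite sub.
apply: ge0_nondecreasing_set_cvg_integral.
- move=> n m nm; rewrite subsetEset => y /=; rewrite !in_itv/=.
  by have := en _ _ nm; rewrite /A /B; move=> ? /andP[? ?]; apply/andP; split; lra.
- by move=> n; exact: measurable_itv.
- move=> n; apply: (@measurable_funS _ _ _ _ `]a, b[) => //.
    by rewrite -bigx => x xn; exists n.
  apply/measurable_EFinP; apply: open_continuous_measurable_fun => //.
  move=> x; rewrite inE => xab; apply: cvgM; last exact: cq.
  by apply: continuous_comp; [exact: cpA|apply/cG/pin].
- move=> n y /Aab yn; rewrite lee_fin mulr_ge0 ?G0 ?pin//.
  exact/ltW/q0.
by rewrite -bigx -bigy -(cvg_lim _ limy)// -(cvg_lim _ limx).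
Qed.

(* The pointwise operations on functions are restated with explicit lambda
   terms, the form in which they arise below. *)
Section real_derive.
Context {R : realType}.
Implicit Types (f g : R -> R) (x a b c : R).

Lemma is_derive_addf f g x a b : is_derive x 1 f a -> is_derive x 1 g b ->
  is_derive x 1 (fun y => f y + g y) (a + b).
Proof. exact: is_deriveD. Qed.

Lemma is_derive_subf f g x a b : is_derive x 1 f a -> is_derive x 1 g b ->
  is_derive x 1 (fun y => f y - g y) (a - b).
Proof. exact: is_deriveB. Qed.

Lemma is_derive_mulf f g x a b : is_derive x 1 f a -> is_derive x 1 g b ->
  is_derive x 1 (fun y => f y * g y) (a * g x + f x * b).
Proof. 
by move=> fa gb; apply: is_derive_eq (is_deriveM fa gb) _; rewrite addrC [_ *: a]mulrC.
Qed.

Lemma is_derive_scalef f x a c : is_derive x 1 f a ->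
  is_derive x 1 (fun y => c * f y) (c * a).
Proof. exact: is_deriveZ. Qed.

Lemma is_derive_compf f g x a b : is_derive (g x) 1 f a -> is_derive x 1 g b ->
  is_derive x 1 (fun y => f (g y)) (a * b).
Proof. exact: is_derive1_comp. Qed.

Lemma is_derive_ext f g x a : (forall y, f y = g y) ->
  is_derive x 1 f a -> is_derive x 1 g a.
Proof. by move=> /funext ->. Qed.

End real_derive.

Section real_continuity.
Context {R : realType}.
Implicit Types (f g : R -> R) (x : R).

Lemma continuous_addf f g x : continuous_at x f -> continuous_at x g ->
  continuous_at x (fun y => f y + g y).
Proof. exact: continuousD. Qed.

Lemma continuous_subf f g x : continuous_at x f -> continuous_at x g ->
  continuous_at x (fun y => f y - g y).
Proof. exact: continuousB. Qed.

Lemma continuous_mulf f g x : continuous_at x f -> continuous_at x g ->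
  continuous_at x (fun y => f y * g y).
Proof. exact: continuousM. Qed.

Lemma continuous_compf f g x : continuous_at x g ->
  continuous_at (g x) f -> continuous_at x (fun y => f (g y)).
Proof. exact: continuous_comp. Qed.

Lemma continuous_maxf f g x : continuous_at x f -> continuous_at x g ->
  continuous_at x (fun y => Num.max (f y) (g y)).
Proof. by move=> cf cg; exact: (@continuous_max _ _ f g x cf cg). Qed.

Lemma continuous_minf f g x : continuous_at x f -> continuous_at x g ->
  continuous_at x (fun y => Num.min (f y) (g y)).
Proof. by move=> cf cg; exact: (@continuous_min _ _ f g x cf cg). Qed.

Lemma continuous_oppf f x : continuous_at x f ->
  continuous_at x (fun y => - f y).
Proof. exact: continuousN. Qed.

Lemma continuous_id x : continuous_at x (fun y : R => y).
Proof. exact: cvg_id. Qed.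

Lemma is_derive_continuous f x a : is_derive x 1 f a -> continuous_at x f.
Proof.
by case=> df _; apply: differentiable_continuous; exact/derivable1_diffP.
Qed.

End real_continuity.

Local Notation mu := lebesgue_measure.

Lemma integral_subst_oo {R : realType} (p q G : R -> R) (a b : R) :
  a < b ->
  {within `[a, b], continuous p} ->
  (forall x, x \in `]a, b[ -> is_derive x 1 p (q x)) ->
  (forall x, x \in `]a, b[ -> {for x, continuous q}) ->
  (forall x, x \in `]a, b[ -> 0 < q x) ->
  (forall y, y \in `]p a, p b[ -> {for y, continuous G}) ->
  (\int[mu]_(y in `]p a, p b[) (G y)%:E =
   \int[mu]_(x in `]a, b[) (G (p x) * q x)%:E)%E.
Proof.
move=> ab cp dp cq q0 cG.
rewrite [LHS]integralE [RHS]integralE; congr (_ - _)%E.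
- under eq_integral => y _ do rewrite funeposE -EFin_max.
  rewrite (@ge0_integral_subst_oo _ p q (fun y => Num.max (G y) 0) a b)//.
  + apply: eq_integral => x /set_mem /= xab.
    by rewrite funeposE -EFin_max maxr_pMl ?mul0r// ltW// q0.
  + by move=> y yab; apply: continuous_max; [exact: cG|exact: cst_continuous].
  + by move=> y _; rewrite le_max lexx orbT.
- under eq_integral => y _ do rewrite funenegE -EFinN -EFin_max.
  rewrite (@ge0_integral_subst_oo _ p q (fun y => Num.max (- G y) 0) a b)//.
  + apply: eq_integral => x /set_mem /= xab.
    by rewrite funenegE -EFinN -EFin_max maxr_pMl ?mul0r ?mulNr// ltW// q0.
  + move=> y yab; apply: continuous_max; last exact: cst_continuous.
    by apply: (@continuous_oppf R); exact: cG.
  + by move=> y _; rewrite le_max lexx orbT.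
Qed.

Lemma integral_affine {R : realType} (G : R -> R) (c d : R) : 0 < d ->
  (forall y, y \in `]c, c + d[ -> continuous_at y G) ->
  (\int[mu]_(y in `]c, (c + d)%R[) (G y)%:E =
   \int[mu]_(x in `]0%R, 1%R[) (G (c + d * x) * d)%:E)%E.
Proof.
move=> d0 cG.
have := @integral_subst_oo R (fun x => c + d * x) (fun=> d) G 0 1 ltr01.
rewrite mulr0 addr0 mulr1; apply => //.
- apply: continuous_subspaceT => x; apply: (@continuous_addf R).
    exact: cst_continuous.
  by apply: (@continuous_mulf R); [exact: cst_continuous|exact: continuous_id].
- move=> x _; apply: is_derive_eq
    (is_derive_addf (is_derive_cst _ _ _) (is_derive_scalef _ (is_derive_id _ _))) _.
  by rewrite mulr1 add0r.
- by move=> x _; exact: cst_continuous.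
Qed.

(** * The Riemann-Liouville integral *)

(** The power function extended by 0 to the left, so that for a > 0 it is
    continuous on the whole line. *)
Definition ppow {R : realType} (a x : R) : R := Num.max x 0 `^ a.

Section ppow.
Context {R : realType}.
Implicit Types a x : R.

Lemma ppowE a x : 0 <= x -> ppow a x = x `^ a.
Proof. by move=> x0; rewrite /ppow max_l. Qed.

Lemma ppow_ge0 a x : 0 <= ppow a x. Proof. exact: powR_ge0. Qed.

Lemma ppow_le0 a x : 0 < a -> x <= 0 -> ppow a x = 0.
Proof. by move=> a0 x0; rewrite /ppow max_r// powR0// gt_eqF. Qed.

Lemma is_derive_ppow a x : 0 < x -> is_derive x 1 (ppow a) (a * x `^ (a - 1)).
Proof.
move=> x0; apply: near_eq_is_derive (is_derive1_powR a x0).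
by near=> y; rewrite ppowE// ltW//; near: y; exact: lt_nbhsr.
Unshelve. all: by end_near. Qed.

Lemma continuous_powR a x : 0 < x -> {for x, continuous (fun y : R => y `^ a)}.
Proof.
move=> x0; apply: differentiable_continuous; apply/derivable1_diffP.
by case: (is_derive1_powR a x0).
Qed.

Lemma continuous_ppow a : 0 < a -> continuous (ppow a).
Proof.
move=> a0 x; case: (ltgtP x 0) => [x0|x0|->].
- rewrite /continuous_at ppow_le0 ?ltW//.
  apply: (cvg_trans _ (@cvg_cst _ _ _ (nbhs x) _ : (fun=> 0) @ x --> (0:R))).
  apply: near_eq_cvg; near=> y; rewrite ppow_le0// ltW//.
  by near: y; exact: lt_nbhsl.
- apply: differentiable_continuous; apply/derivable1_diffP.
  by case: (is_derive_ppow a x0).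
- apply/left_right_continuousP; rewrite ppow_le0//; split.
    apply: (cvg_trans _ (@cvg_cst _ _ _ (0^'-) _ : (fun=> 0) @ 0^'- --> (0:R))).
    by apply: near_eq_cvg; near=> y; rewrite ppow_le0//.
  apply: cvg_trans (powR_cvg0 a0); apply: near_eq_cvg; near=> y.
  by rewrite ppowE.
Unshelve. all: by end_near. Qed.

End ppow.

Lemma continuous_onem_powR {R : realType} (c x : R) : x < 1 ->
  {for x, continuous (fun y : R => (1 - y) `^ c)}.
Proof.
move=> x1; apply: (@continuous_compf R (fun z => z `^ c) (fun y => 1 - y)).
  by apply: (@continuous_subf R); [exact: cst_continuous|exact: continuous_id].
by apply: continuous_powR; rewrite subr_gt0.
Qed.

Lemma measurable_fun_powRl d (T : measurableType d) {R : realType} (D : set T)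
    (g : T -> R) (c : R) :
  measurable_fun D g -> measurable_fun D (fun x => g x `^ c).
Proof. exact: (@measurableT_comp _ _ _ _ _ _ (@powR R ^~ c)). Qed.

Lemma bounded_image_itv {R : realType} (g : R -> R) (a b : R) : continuous g ->
  exists M, 0 <= M /\ forall x, a <= x <= b -> `|g x| <= M.
Proof.
move=> cg; have [ab|ab] := leP a b; last first.
  by exists 0; split=> // x /andP[ax xb]; have := le_trans ax xb; lra.
have [|c _ hc] := @EVT_max _ (fun x => `|g x|) a b ab.
  apply: continuous_subspaceT => x; apply: (@cvg_comp _ _ _ g Num.norm).
    exact: cg.
  exact: norm_continuous.
by exists `|g c|; split=> // x xab; apply: hc; rewrite in_itv.
Qed.

Section kernel.
Context {R : realType}.
Implicit Types a b : R.

(** Substitution y = 1 - (1 - x)^a in the integral of a constant. *)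
Lemma ge0_integral_kernel a : 0 < a ->
  (\int[mu]_(x in `]0%R, 1%R[) ((1 - x) `^ (a - 1))%:E = (a^-1)%:E)%E.
Proof.
move=> a0.
have := @ge0_integral_subst_oo R (fun x => 1 - ppow a (1 - x))
  (fun x => a * (1 - x) `^ (a - 1)) (fun=> a^-1) 0 1 ltr01.
rewrite subr0 subrr (@ppow_le0 _ _ 0)// (@ppowE _ _ 1)// powR1 subrr subr0 => subst.
have -> : (\int[mu]_(x in `]0%R, 1%R[) ((1 - x) `^ (a - 1))%:E =
    \int[mu]_(x in `]0%R, 1%R[) (a^-1 * (a * (1 - x) `^ (a - 1)))%:E)%E.
  by apply: eq_integral => x _; rewrite mulKf ?gt_eqF.
transitivity (\int[mu]_(x in `]0%R, 1%R[) (a^-1)%:E : \bar R)%E; last first.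
  by rewrite integral_cst//= lebesgue_measure_itv/= lte_fin ltr01 oppr0 adde0 mule1.
apply/esym/subst.
- apply: continuous_subspaceT => x.
  apply: (@continuous_subf R); first exact: cst_continuous.
  apply: (@continuous_compf R (ppow a) (fun x => 1 - x)).
    by apply: (@continuous_subf R); [exact: cst_continuous|exact: continuous_id].
  exact: continuous_ppow.
- move=> x; rewrite in_itv/= => /andP[x0 x1].
  have d1 : is_derive (1 - x) 1 (ppow a) (a * (1 - x) `^ (a - 1)).
    by apply: is_derive_ppow; rewrite subr_gt0.
  have d2 : is_derive x 1 (fun y : R => 1 - y) (-1).
    apply: is_derive_eq (is_derive_subf (is_derive_cst _ _ _) (is_derive_id _ _)) _.
    by rewrite sub0r.
  apply: is_derive_eq (is_derive_subf (is_derive_cst _ _ _) 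
    (@is_derive_compf R _ (fun y => 1 - y) _ _ _ d1 d2)) _.
  by rewrite mulrN1 sub0r opprK.
- move=> x; rewrite in_itv/= => /andP[x0 x1].
  apply: (@continuous_mulf R); first exact: cst_continuous.
  exact: continuous_onem_powR.
- move=> x; rewrite in_itv/= => /andP[x0 x1].
  by rewrite mulr_gt0// powR_gt0// subr_gt0.
- by move=> y _; exact: cst_continuous.
- by move=> y _; rewrite invr_ge0 ltW.
Qed.

Lemma measurable_itv_continuous (g : R -> R) (c d : R) :
  (forall x, x \in `]c, d[ -> continuous_at x g) -> measurable_fun `]c, d[%classic g.
Proof.
move=> cg; apply: open_continuous_measurable_fun => //.
by move=> x; rewrite inE; exact: cg.
Qed.

Lemma integrable_kernel a (g : R -> R) (M : R) : 0 < a ->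
  measurable_fun `](0 : R), 1[ g -> (forall x, 0 < x < 1 -> `|g x| <= M) ->
  mu.-integrable `]0, 1[ (EFin \o (fun x => (1 - x) `^ (a - 1) * g x)).
Proof.
move=> a0 mg gM.
have ik : mu.-integrable `]0, 1[ (EFin \o (fun x => (1 - x) `^ (a - 1))).
  apply/integrableP; split.
    by apply/measurable_EFinP/measurable_fun_powRl; exact: measurable_funB.
  under eq_integral do rewrite /= ger0_norm ?powR_ge0//.
  by rewrite ge0_integral_kernel// ltry.
apply: (@le_integrable _ _ _ mu _ _ _ (fun x => M%:E * ((1 - x) `^ (a - 1))%:E)%E) => //.
- apply/measurable_EFinP; apply: measurable_funM => //.
  by apply: measurable_fun_powRl; exact: measurable_funB.
- move=> x; rewrite /= in_itv/= => /gM gx.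
  rewrite lee_fin !normrM mulrC ler_wpM2r//.
  exact: le_trans gx (ler_norm _).
- exact: integrableZl.
Qed.

Lemma normr_integral_kernel a (g : R -> R) (M : R) : 0 < a ->
  measurable_fun `](0 : R), 1[ g -> (forall x, 0 < x < 1 -> `|g x| <= M) ->
  `|\int[mu]_(x in `]0, 1[) ((1 - x) `^ (a - 1) * g x)| <= M / a.
Proof.
move=> a0 mg gM.
have M0 : 0 <= M by apply: le_trans (gM 2^-1 _); rewrite ?normr_ge0//; lra.
have ikg := integrable_kernel a0 mg gM.
apply: (le_trans (le_normr_Rintegral _ ikg)) => //.
rewrite -lee_fin /Rintegral fineK; last first.
  by apply: integrable_fin_num => //; exact: integrable_abse ikg.
have -> : ((M / a)%:E = \int[mu]_(x in `]0%R, 1%R[) (M%:E * ((1 - x) `^ (a - 1))%:E))%E.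
  rewrite ge0_integralZl//.
  - by rewrite ge0_integral_kernel.
  - by apply/measurable_EFinP/measurable_fun_powRl; exact: measurable_funB.
  - by move=> x _; rewrite lee_fin powR_ge0.
apply: ge0_le_integral => //.
- apply/measurable_EFinP; apply: measurableT_comp => //; apply: measurable_funM => //.
  by apply: measurable_fun_powRl; exact: measurable_funB.
- apply/measurable_EFinP; apply: measurable_funM => //.
  by apply: measurable_fun_powRl; exact: measurable_funB.
- move=> x; rewrite /= in_itv/= => /gM gx.
  rewrite -EFinM lee_fin normrM (ger0_norm (powR_ge0 _ _)) mulrC.
  by rewrite ler_wpM2r// powR_ge0.
Qed.

Lemma integral_itv_gt0 (g : R -> R) (c d : R) : c < d ->
  measurable_fun `]c, d[%classic g -> (forall x, c < x < d -> 0 < g x) ->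
  (0 < \int[mu]_(x in `]c, d[) (g x)%:E)%E.
Proof.
move=> cd mg g0; rewrite lt0e integral_ge0 ?andbT; last first.
  by move=> x; rewrite /= in_itv/= => /g0/ltW; rewrite lee_fin.
apply/eqP => I0.
have mG : measurable_fun `]c, d[ (EFin \o g) by exact/measurable_EFinP.
have /(ae_eq_integral_abs mu _ mG).1 : (\int[mu]_(x in `]c, d[) `|(EFin \o g) x| = 0)%E.
  rewrite -[RHS]I0; apply: eq_integral => x; rewrite inE/= in_itv/= => /g0 gx.
  by rewrite ger0_norm// ltW.
move=> /(_ (measurable_itv _)) [N [mN N0 sub]].
have : (mu `]c, d[ <= mu N)%E.
  apply: le_measure; rewrite ?inE//; apply: subset_trans sub => x xcd /= h.
  have := g0 x; rewrite /= in_itv/= in xcd; move=> /(_ xcd).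
  by have := h ltac:(by rewrite /= in_itv); move=> [->]; rewrite ltxx.
by rewrite N0 lebesgue_measure_itv/= lte_fin cd -EFinD lee_fin leNgt subr_gt0 cd.
Qed.

End kernel.

(** Gamma(a) times the Riemann-Liouville integral of order a, in the form
    obtained by scaling [0, u] to [0, 1]: the singular kernel no longer depends
    on u, so that continuity in u follows by dominated convergence. *)
Definition RL {R : realType} (a : R) (phi : R -> R) (u : R) : R :=
  ppow a u * \int[mu]_(x in `]0, 1[) ((1 - x) `^ (a - 1) * phi (u * x)).

Section RL.
Context {R : realType}.
Implicit Types (a b u : R) (phi psi : R -> R).

Lemma measurable_dilation phi u : continuous phi ->
  measurable_fun `](0 : R), 1[ (fun x => phi (u * x)).
Proof.
move=> cphi; apply: measurable_itv_continuous => x _.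
apply: (@continuous_compf R phi (fun x => u * x)); last exact: cphi.
by apply: (@continuous_mulf R); [exact: cst_continuous|exact: continuous_id].
Qed.

Lemma mulr_itvoo u x : 0 < u -> 0 < x < 1 -> 0 < u * x < u.
Proof. by move=> u0 /andP[x0 x1]; rewrite mulr_gt0// gtr_pMr. Qed.

Lemma integrable_RL a phi u : 0 < a -> continuous phi ->
  mu.-integrable `]0, 1[ (EFin \o (fun x => (1 - x) `^ (a - 1) * phi (u * x))).
Proof.
move=> a0 cphi; have [M [M0 hM]] := bounded_image_itv (- `|u|) `|u| cphi.
apply: (integrable_kernel (M := M)) => //; first exact: measurable_dilation.
move=> x /andP[x0 x1]; apply: hM; rewrite -ler_norml normrM.
by rewrite (gtr0_norm x0) ler_piMr// ltW.
Qed.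

Lemma RL_le0 a phi u : 0 < a -> u <= 0 -> RL a phi u = 0.
Proof. by move=> a0 u0; rewrite /RL ppow_le0// mul0r. Qed.

Lemma eq_RL a phi psi u : 0 < a ->
  (forall v, 0 < v < u -> phi v = psi v) -> RL a phi u = RL a psi u.
Proof.
move=> a0 h; have [u0|u0] := leP u 0; first by rewrite !RL_le0.
congr (_ * _); apply: eq_Rintegral => x; rewrite inE/= in_itv/= => xI.
by rewrite h// mulr_itvoo.
Qed.

Lemma normr_RL a phi u (M : R) : 0 < a -> continuous phi ->
  (forall v, 0 < v < u -> `|phi v| <= M) -> `|RL a phi u| <= M / a * ppow a u.
Proof.
move=> a0 cphi h; have [u0|u0] := leP u 0.
  by rewrite RL_le0// ppow_le0// normr0 mulr0.
rewrite normrM ger0_norm ?ppow_ge0// mulrC ler_wpM2r ?ppow_ge0//.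
apply: normr_integral_kernel => //; first exact: measurable_dilation.
by move=> x xI; apply: h; exact: mulr_itvoo.
Qed.

Lemma RL_sub a phi psi u : 0 < a -> continuous phi -> continuous psi ->
  RL a (fun v => phi v - psi v) u = RL a phi u - RL a psi u.
Proof.
move=> a0 cphi cpsi; rewrite /RL -mulrBr; congr (_ * _).
rewrite -RintegralB//; [|exact: integrable_RL..].
by apply: eq_Rintegral => x _; rewrite mulrBr.
Qed.

Lemma RL_scale a c phi u : 0 < a -> continuous phi ->
  RL a (fun v => c * phi v) u = c * RL a phi u.
Proof.
move=> a0 cphi; rewrite /RL mulrCA; congr (_ * _).
rewrite -RintegralZl//; last exact: integrable_RL.
by apply: eq_Rintegral => x _; rewrite mulrCA.
Qed.

(** The kernel times a bound of phi dominates the integrands for all parameters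
    near u. *)
Lemma continuous_RL a phi : 0 < a -> continuous phi -> continuous (RL a phi).
Proof.
move=> a0 cphi u; apply: (@continuous_mulf R); first exact: continuous_ppow.
have [M [M0 hM]] := bounded_image_itv (- (`|u| + 1)) (`|u| + 1) cphi.
have ik : mu.-integrable `](0 : R), 1[ (EFin \o (fun x => (1 - x) `^ (a - 1) * M)).
  by apply: (integrable_kernel (M := M)) => //; rewrite ger0_norm.
apply: (@continuity_under_integral R _ _ mu
   (fun l x => (1 - x) `^ (a - 1) * phi (l * x)) `]0, 1[ _ (u - 1) (u + 1) _ _
   (fun x => (1 - x) `^ (a - 1) * M)) => //.
- by move=> x _; exact: integrable_RL.
- apply: aeW => y _ x _; apply: (@continuous_mulf R); first exact: cst_continuous.
  apply: (@continuous_compf R phi (fun x => x * y)); last exact: cphi.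
  by apply: (@continuous_mulf R); [exact: continuous_id|exact: cst_continuous].
- move=> x /=; rewrite in_itv/= => /andP[x1 x2].
  apply: aeW => y /=; rewrite in_itv/= => /andP[y0 y1].
  rewrite normrM ger0_norm ?powR_ge0// ler_wpM2l ?powR_ge0//.
  apply: hM; rewrite -ler_norml normrM (gtr0_norm y0).
  apply: (@le_trans _ _ `|x|); first by rewrite ler_piMr// ltW.
  rewrite -(subrK u x) addrC (le_trans (ler_normD _ _))// lerD2l.
  by rewrite ler_norml; apply/andP; split; lra.
- by rewrite inE/= in_itv/=; apply/andP; split; lra.
Qed.

Lemma integral_dilation phi u : 0 < u -> continuous phi ->
  \int[mu]_(v in `]0, u[) phi v = u * \int[mu]_(x in `]0, 1[) phi (u * x).
Proof.
move=> u0 cphi.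
have subst := @integral_affine R phi 0 u u0 (fun y _ => cphi y).
rewrite add0r in subst.
have ip : mu.-integrable `]0, 1[ (EFin \o (fun x => phi (u * x))).
  have := integrable_RL u ltr01 cphi; congr (mu.-integrable _ (EFin \o _)).
  by apply/funext => x; rewrite subrr powRr0 mul1r.
rewrite -RintegralZl// /Rintegral subst; congr fine.
by apply: eq_integral => x _; rewrite mulrC add0r.
Qed.

Lemma is_derive_RL1 phi u : 0 < u -> continuous phi ->
  is_derive u 1 (RL 1 phi) (phi u).
Proof.
move=> u0 cphi.
have ip v : mu.-integrable `[0, v] (EFin \o phi).
  apply: continuous_compact_integrable; first exact: segment_compact.
  exact: continuous_subspaceT.
have E v : 0 < v -> RL 1 phi v = \int[mu]_(t in `[0, v]) phi t.
  move=> v0; rewrite /RL ppowE ?ltW// powRr1 ?ltW//.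
  under eq_Rintegral do rewrite subrr powRr0 mul1r.
  rewrite -integral_dilation// Rintegral_itv_obnd_cbnd; last first.
    apply: (integrableS _ _ _ (ip v)) => //.
    exact: subset_itv_oo_cc.
  rewrite Rintegral_itv_bndo_bndc//.
  by apply: (integrableS _ _ _ (ip v)) => //; exact: subset_itv_co_cc.
have [|d1 d2] := @continuous_FTC1_closed R phi 0 u (u + 1) _ (ip _) u0 (cphi u).
  by lra.
have : is_derive u 1 (fun v => \int[mu]_(t in `[0, v]) phi t) (phi u).
  by split; [exact: d1|rewrite -derive1E; exact: d2].
apply: near_eq_is_derive; near=> v; rewrite E//; near: v; exact: lt_nbhsr.
Unshelve. all: by end_near. Qed.

End RL.

Definition betaR {R : realType} (a b : R) : R :=
  \int[mu]_(x in `]0, 1[) ((1 - x) `^ (a - 1) * x `^ (b - 1)).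

Section semigroup.
Context {R : realType}.
Implicit Types (a b u : R) (phi psi chi : R -> R).

Let betae a b : \bar R :=
  (\int[mu]_(x in `]0%R, 1%R[) ((1 - x) `^ (a - 1) * x `^ (b - 1))%:E)%E.

Lemma RL_dilation a phi u v : 0 < u -> 0 < v ->
  RL a phi (u * v) = u `^ a * RL a (fun z => phi (u * z)) v.
Proof.
move=> u0 v0; rewrite /RL !ppowE ?mulr_ge0 ?ltW// powRM ?ltW// -mulrA.
congr (_ * (_ * _)).
by apply: eq_Rintegral => x _; rewrite mulrA.
Qed.

Lemma RL_at1 a phi :
  RL a phi 1 = \int[mu]_(x in `]0, 1[) ((1 - x) `^ (a - 1) * phi x).
Proof.
rewrite /RL ppowE// powR1 mul1r.
by under eq_Rintegral do rewrite mul1r.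
Qed.

Lemma RL_kernel b chi x : 0 < b -> 0 < x -> continuous chi ->
  ((RL b chi x)%:E =
   \int[mu]_(z in `]0%R, x[) ((x - z) `^ (b - 1) * chi z)%:E)%E.
Proof.
move=> b0 x0 cchi.
have := @integral_affine R (fun z => (x - z) `^ (b - 1) * chi z) 0 x x0.
rewrite add0r => ->.
  rewrite /RL ppowE ?ltW// EFinM /Rintegral fineK; last first.
    by apply: integrable_fin_num => //; exact: integrable_RL.
  rewrite -integralZl//; last exact: integrable_RL.
  apply: eq_integral => y; rewrite inE/= in_itv/= => /andP[y0 y1].
  rewrite -EFinM add0r; congr EFin.
  have -> : x - x * y = x * (1 - y) by ring.
  rewrite powRM ?ltW ?subr_gt0// -[in LHS](mulr_powRB1 (ltW x0) b0).
  by ring.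
move=> z; rewrite in_itv/= => /andP[z0 zx].
apply: (@continuous_mulf R); last exact: cchi.
apply: (@continuous_compf R (fun z => z `^ (b - 1)) (fun z => x - z)).
  by apply: (@continuous_subf R); [exact: cst_continuous|exact: continuous_id].
by apply: continuous_powR; rewrite subr_gt0.
Qed.

(** The inner integral after exchanging the order of integration: the affine map
    from ]0, 1[ to ]z, 1[ turns it into a Beta integral. *)
Lemma beta_kernel a b z : 0 < a -> 0 < b -> 0 < z < 1 ->
  (\int[mu]_(x in `]z, 1%R[) ((1 - x) `^ (a - 1) * (x - z) `^ (b - 1))%:E =
   ((1 - z) `^ (a + b - 1))%:E * betae a b)%E.
Proof.
move=> a0 b0 /andP[z0 z1].
have z10 : 0 < 1 - z by rewrite subr_gt0.
have := @integral_affine R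
  (fun x => (1 - x) `^ (a - 1) * (x - z) `^ (b - 1)) z (1 - z) z10.
rewrite subrKC => ->.
  rewrite -ge0_integralZl//.
  + apply: eq_integral => w; rewrite inE/= in_itv/= => /andP[w0 w1].
    rewrite -EFinM; congr EFin.
    have -> : 1 - (z + (1 - z) * w) = (1 - z) * (1 - w) by ring.
    have -> : z + (1 - z) * w - z = (1 - z) * w by ring.
    rewrite !powRM ?ltW ?subr_gt0//.
    have -> : a + b - 1 = (a - 1) + ((b - 1) + 1) by ring.
    rewrite (powRD (r := a - 1)) ?(powRD (r := b - 1)) ?(gt_eqF z10) ?implybT//.
    by rewrite powRr1 ?ltW//; ring.
  + apply/measurable_EFinP; apply: measurable_funM; apply: measurable_fun_powRl => //.
    exact: measurable_funB.
  + by move=> w _; rewrite lee_fin mulr_ge0 ?powR_ge0.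
  + by rewrite lee_fin powR_ge0.
move=> y; rewrite in_itv/= => /andP[zy y1].
apply: (@continuous_mulf R); first exact: continuous_onem_powR.
apply: (@continuous_compf R (fun z => z `^ (b - 1)) (fun y => y - z)).
  by apply: (@continuous_subf R); [exact: continuous_id|exact: cst_continuous].
by apply: continuous_powR; rewrite subr_gt0.
Qed.

(** Tonelli on the triangle 0 < z < x < 1.  Stated in extended reals, so that it
    also yields finiteness of the Beta integral. *)
Lemma ge0_RL_convolution a b chi : 0 < a -> 0 < b -> continuous chi ->
  (forall z, 0 <= chi z) ->
  (\int[mu]_(x in `]0%R, 1%R[) ((1 - x) `^ (a - 1) * RL b chi x)%:E =
   betae a b *
   \int[mu]_(z in `]0%R, 1%R[) ((1 - z) `^ (a + b - 1) * chi z)%:E)%E.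
Proof.
move=> a0 b0 cchi chi0.
pose P := `](0 : R), +oo[%classic.
(* The indicators cut out the triangle 0 < p.2 < p.1 < 1. *)
pose k (p : R * R) : \bar R := ((\1_P p.2 * \1_P (p.1 - p.2) * \1_P (1 - p.1)) *
  ((1 - p.1) `^ (a - 1) * (p.1 - p.2) `^ (b - 1) * chi p.2))%:E.
have k0 p : (0 <= k p)%E.
  by rewrite lee_fin !mulr_ge0 ?powR_ge0.
have mP (g : R * R -> R) : measurable_fun setT g ->
    measurable_fun setT (fun p => \1_P (g p) : R).
  move=> mg; apply: (@measurableT_comp _ _ _ _ _ _ (\1_P : R -> R)) => //.
  by apply: measurable_indic; exact: measurable_itv.
have m12 : measurable_fun setT (fun p : R * R => p.1 - p.2).
  by apply: measurable_funB; [exact: measurable_fst|exact: measurable_snd].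
have m1 : measurable_fun setT (fun p : R * R => 1 - p.1).
  by apply: measurable_funB => //; exact: measurable_fst.
have mk : measurable_fun setT k.
  apply/measurable_EFinP; apply: measurable_funM.
    apply: measurable_funM; last exact: mP.
    by apply: measurable_funM; apply: mP => //; exact: measurable_snd.
  apply: measurable_funM.
    by apply: measurable_funM; exact: measurable_fun_powRl.
  apply: (measurableT_comp _ (@measurable_snd _ _ _ _)) => //.
  exact: continuous_measurable_fun.
have := fubini_tonelli (m1 := mu) (m2 := mu) k mk k0.
have kI (x z : R) : k (x, z) = if [&& 0 < z, z < x & x < 1] then
    ((1 - x) `^ (a - 1) * ((x - z) `^ (b - 1) * chi z))%:E else 0%E.
  have PE (y : R) : \1_P y = (0 < y)%R%:R :> R.
    by rewrite indicE /P mem_setE in_itv/= andbT.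
  rewrite /k/= !PE !subr_gt0.
  case: (0 < z); rewrite ?mul0r//.
  case: (z < x); rewrite ?mulr0 ?mul0r//.
  by case: (x < 1); rewrite ?mulr0 ?mul0r// !mulr1 mul1r mulrA.
have -> : (\int[mu]_x \int[mu]_y k (x, y) =
    \int[mu]_(x in `]0%R, 1%R[) ((1 - x) `^ (a - 1) * RL b chi x)%:E)%E.
  rewrite [RHS]integral_mkcond; apply: eq_integral => x _; rewrite patchE.
  case: ifPn => [|xI].
    rewrite inE/= in_itv/= => /andP[x0 x1].
    rewrite EFinM RL_kernel// -ge0_integralZl//.
    - rewrite [RHS]integral_mkcond; apply: eq_integral => z _.
      rewrite patchE kI x1 andbT; congr (if _ then _ else _).
      by rewrite mem_setE in_itv.
    - apply/measurable_EFinP; apply: measurable_funM.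
        by apply: measurable_fun_powRl; exact: measurable_funB.
      by apply: measurable_funTS; exact: continuous_measurable_fun.
    - by move=> z _; rewrite lee_fin mulr_ge0 ?powR_ge0.
    - by rewrite lee_fin powR_ge0.
  apply: integral0_eq => z _; rewrite kI; case: ifPn => // /and3P[z0 zx x1].
  by move: xI; rewrite notin_setE/= in_itv/= (lt_trans z0 zx) x1.
move=> ->.
rewrite -ge0_integralZl//; first last.
- by apply: integral_ge0 => x _; rewrite lee_fin mulr_ge0 ?powR_ge0.
- by move=> z _; rewrite lee_fin mulr_ge0 ?powR_ge0.
- apply/measurable_EFinP; apply: measurable_funM.
    by apply: measurable_fun_powRl; exact: measurable_funB.
  by apply: measurable_funTS; exact: continuous_measurable_fun.
rewrite [RHS]integral_mkcond; apply: eq_integral => z _; rewrite patchE.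
case: ifPn => [|zI].
  rewrite inE/= in_itv/= => zI; have /andP[z0 z1] := zI.
  rewrite EFinM muleA [(betae _ _ * _)%E]muleC -beta_kernel// muleC -ge0_integralZl//.
  - rewrite [RHS]integral_mkcond; apply: eq_integral => x _.
    rewrite patchE kI z0/=.
    rewrite (_ : (x \in `]z, 1[%classic) = (z < x < 1)); last first.
      by rewrite mem_setE in_itv.
    by case: ifP => // _; rewrite -EFinM; congr EFin; ring.
  - apply/measurable_EFinP; apply: measurable_funM; apply: measurable_fun_powRl => //.
      exact: measurable_funB.
    exact: measurable_funB.
  - by move=> x _; rewrite lee_fin mulr_ge0 ?powR_ge0.
  - by rewrite lee_fin.
apply: integral0_eq => x _; rewrite kI; case: ifPn => // /and3P[z0 zx x1].
by move: zI; rewrite notin_setE/= in_itv/= (lt_trans zx x1) z0.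
Qed.

(** Taking chi = 1 in the convolution formula, the left-hand side is finite
    because [RL b 1] is bounded, and the right-hand side is the Beta integral
    times 1 / (a + b). *)
Lemma beta_lty a b : 0 < a -> 0 < b -> (betae a b < +oo)%E.
Proof.
move=> a0 b0.
have c1 : continuous (fun _ : R => 1 : R) by move=> x; exact: cst_continuous.
have := ge0_RL_convolution a0 b0 c1 (fun=> ler01).
under [X in (_ = _ * X)%E]eq_integral do rewrite mulr1.
rewrite ge0_integral_kernel ?addr_gt0// => E.
have : (betae a b * ((a + b)^-1)%:E < +oo)%E.
  rewrite -E; suff /integrable_fin_num : mu.-integrable `](0 : R), 1[
    (EFin \o (fun x => (1 - x) `^ (a - 1) * RL b (fun=> 1) x)).
    by move=> /(_ (measurable_itv _)); rewrite fin_numElt => /andP[].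
  have [M [_ hM]] := bounded_image_itv 0 1 (continuous_RL b0 c1).
  apply: (integrable_kernel (M := M)) => //.
    by apply: measurable_itv_continuous => x _; exact: continuous_RL.
  by move=> x /andP[x0 x1]; apply: hM; rewrite !ltW.
have [->|ne] := eqVneq (betae a b) +oo%E; last by move=> _; rewrite ltey ne.
by rewrite gt0_mulye// lte_fin invr_gt0 addr_gt0.
Qed.

Lemma betaR_gt0 a b : 0 < a -> 0 < b -> 0 < betaR a b.
Proof.
move=> a0 b0; rewrite fine_gt0// beta_lty// andbT.
apply: integral_itv_gt0 => //.
  apply: measurable_funM; apply: measurable_fun_powRl => //.
  exact: measurable_funB.
by move=> x /andP[x0 x1]; rewrite mulr_gt0// powR_gt0// subr_gt0.
Qed.

(** By dilation it suffices to treat u = 1, which is the convolution formula. *)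
Lemma ge0_RL_semigroup a b phi u : 0 < a -> 0 < b -> continuous phi ->
  (forall x, 0 <= phi x) -> RL a (RL b phi) u = betaR a b * RL (a + b) phi u.
Proof.
move=> a0 b0 cphi phi0; have [u0|u0] := leP u 0.
  by rewrite !RL_le0 ?mulr0// addr_gt0.
pose chi z := phi (u * z).
have cchi : continuous chi.
  move=> x; apply: (@continuous_compf R phi (fun x => u * x)); last exact: cphi.
  by apply: (@continuous_mulf R); [exact: cst_continuous|exact: continuous_id].
rewrite -(mulr1 u) !RL_dilation//.
have -> : RL a (fun z => RL b phi (u * z)) 1 = u `^ b * RL a (RL b chi) 1.
  rewrite -RL_scale//; last exact: continuous_RL.
  by apply: eq_RL => // z /andP[z0 _]; rewrite RL_dilation.
rewrite mulrA -powRD ?(gt_eqF u0) ?implybT// [RHS]mulrCA; congr (_ * _).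
rewrite !RL_at1.
transitivity (fine (betae a b *
    \int[mu]_(z in `]0%R, 1%R[) ((1 - z) `^ (a + b - 1) * chi z)%:E)%E).
  by rewrite -ge0_RL_convolution// => z; exact: phi0.
rewrite fineM//.
- by rewrite ge0_fin_numE ?beta_lty// integral_ge0// => x _; rewrite lee_fin mulr_ge0 ?powR_ge0.
- apply: integrable_fin_num => //.
  have := integrable_RL 1 (addr_gt0 a0 b0) cchi; congr (mu.-integrable _ (EFin \o _)).
  by apply/funext => x; rewrite mul1r.
Qed.

Lemma RL_semigroup a b phi u : 0 < a -> 0 < b -> continuous phi ->
  RL a (RL b phi) u = betaR a b * RL (a + b) phi u.
Proof.
move=> a0 b0 cphi.
pose pos (x : R) : R := Num.max (phi x) 0.
pose neg (x : R) : R := Num.max (- phi x) 0.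
have cpos : continuous pos.
  by move=> x; apply: (@continuous_maxf R); [exact: cphi|exact: cst_continuous].
have cneg : continuous neg.
  move=> x; apply: (@continuous_maxf R); last exact: cst_continuous.
  by apply: (@continuous_oppf R); exact: cphi.
have phiE x : phi x = pos x - neg x.
  rewrite /pos /neg; have [h|/ltW h] := leP (phi x) 0.
    by rewrite max_l ?oppr_ge0// sub0r opprK.
  by rewrite max_r ?oppr_le0// subr0.
have -> : phi = (fun x => pos x - neg x) by apply/funext.
have ab0 := addr_gt0 a0 b0.
rewrite RL_sub// mulrBr -!ge0_RL_semigroup//; last 2 first.
- by move=> x; rewrite le_max lexx orbT.
- by move=> x; rewrite le_max lexx orbT.
rewrite -RL_sub; [|by []|exact: continuous_RL..].
by apply: eq_RL => // v _; rewrite RL_sub.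
Qed.

Lemma betaR_a1 a : 0 < a -> betaR a 1 = a^-1.
Proof.
move=> a0; rewrite /betaR /Rintegral.
under eq_integral do rewrite subrr powRr0 mulr1.
by rewrite ge0_integral_kernel.
Qed.

Lemma ge0_integral_powR a : 0 < a ->
  (\int[mu]_(x in `]0%R, 1%R[) (x `^ (a - 1))%:E = (a^-1)%:E)%E.
Proof.
move=> a0.
have := @ge0_integral_subst_oo R (ppow a) (fun x => a * x `^ (a - 1))
  (fun=> a^-1) 0 1 ltr01.
rewrite (@ppow_le0 _ _ 0)// (@ppowE _ _ 1)// powR1 => subst.
have -> : (\int[mu]_(x in `]0%R, 1%R[) (x `^ (a - 1))%:E =
    \int[mu]_(x in `]0%R, 1%R[) (a^-1 * (a * x `^ (a - 1)))%:E)%E.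
  by apply: eq_integral => x _; rewrite mulKf ?gt_eqF.
suff <- : (\int[mu]_(x in `]0%R, 1%R[) (a^-1)%:E =
    \int[mu]_(x in `]0%R, 1%R[) (a^-1 * (a * x `^ (a - 1)))%:E)%E.
  by rewrite integral_cst//= lebesgue_measure_itv/= lte_fin ltr01 oppr0 adde0 mule1.
apply: subst.
- by apply: continuous_subspaceT => x; exact: continuous_ppow.
- by move=> x; rewrite in_itv/= => /andP[x0 _]; exact: is_derive_ppow.
- move=> x; rewrite in_itv/= => /andP[x0 _].
  by apply: (@continuous_mulf R); [exact: cst_continuous|exact: continuous_powR].
- by move=> x; rewrite in_itv/= => /andP[x0 _]; rewrite mulr_gt0// powR_gt0.
- by move=> y _; exact: cst_continuous.
- by move=> y _; rewrite invr_ge0 ltW.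
Qed.

Lemma betaR_1a a : 0 < a -> betaR 1 a = a^-1.
Proof.
move=> a0; rewrite /betaR /Rintegral.
under eq_integral do rewrite subrr powRr0 mul1r.
by rewrite ge0_integral_powR.
Qed.

Lemma RL_commute1 a phi u : 0 < a -> continuous phi ->
  RL a (RL 1 phi) u = RL 1 (RL a phi) u.
Proof.
move=> a0 cphi.
rewrite (RL_semigroup u a0 ltr01 cphi) (RL_semigroup u ltr01 a0 cphi).
by rewrite (betaR_a1 a0) (betaR_1a a0) addrC.
Qed.

End semigroup.

(** * Iterated integrals and the exponential weight *)

Lemma exists_large_powRN {R : realType} (e d : R) : 0 < e -> 0 < d ->
  exists2 L : R, 0 < L & forall l, L <= l -> l `^ (- e) <= d.
Proof.
move=> e0 d0; exists (d `^ (- e^-1)); first exact: powR_gt0.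
move=> l Ll; have l0 : 0 < l by apply: lt_le_trans Ll; exact: powR_gt0.
rewrite powRN -[leRHS]invrK lef_pV2 ?posrE ?powR_gt0 ?invr_gt0//.
have -> : d^-1 = (d `^ (- e^-1)) `^ e.
  by rewrite -powRrM mulNr mulVf ?gt_eqF// powRN powRr1// ltW.
by rewrite ge0_ler_powR// ?nnegrE ?powR_ge0 ?ltW.
Qed.

(** Used at the point lambda u (1 - x): it trades exponential decay for a negative
    power of lambda, at the price of an integrable singularity. *)
Lemma expRN_le_powRN {R : realType} (e x : R) : 0 < e <= 1 -> 0 < x ->
  expR (- x) <= x `^ (- e).
Proof.
move=> /andP[e0 e1] x0; rewrite expRN powRN lef_pV2 ?posrE ?expR_gt0 ?powR_gt0//.
apply: (@le_trans _ _ (1 + x)); last exact: expR_ge1Dx.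
have [x1|/ltW x1] := leP x 1.
  rewrite (@le_trans _ _ 1) ?lerDl ?(ltW x0)//.
  rewrite [leRHS](_ : 1 = 1 `^ e); last by rewrite powR1.
  by rewrite ge0_ler_powR ?nnegrE ?ler01 ?(ltW e0) ?(ltW x0).
by rewrite (le_trans (ler1_powR x1 e1))// lerDr.
Qed.

Section volterra.
Context {R : realType}.
Implicit Types (a b u : R) (phi psi : R -> R) (n : nat).

Definition iterint n phi : R -> R := iter n (RL 1) phi.

Lemma continuous_iterint n phi : continuous phi -> continuous (iterint n phi).
Proof. by move=> cphi; elim: n => [|n IHn]//=; exact: continuous_RL. Qed.

Lemma is_derive_iterint n phi u : 0 < u -> continuous phi ->
  is_derive u 1 (iterint n.+1 phi) (iterint n phi u).
Proof. by move=> u0 cphi; apply: is_derive_RL1 => //; exact: continuous_iterint. Qed.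

Lemma iterint_scale n c phi : continuous phi ->
  iterint n (fun v => c * phi v) = (fun v => c * iterint n phi v).
Proof.
move=> cphi; elim: n => [//|n IHn]; apply/funext => u.
by rewrite [LHS]/= -/(iterint n _) IHn RL_scale//; exact: continuous_iterint.
Qed.

Lemma iterint_sub n phi psi : continuous phi -> continuous psi ->
  iterint n (fun v => phi v - psi v) = (fun v => iterint n phi v - iterint n psi v).
Proof.
move=> cphi cpsi; elim: n => [//|n IHn]; apply/funext => u.
by rewrite [LHS]/= -/(iterint n _) IHn RL_sub//; exact: continuous_iterint.
Qed.

Lemma RL_iterint a n phi : 0 < a -> continuous phi ->
  RL a (iterint n phi) = iterint n (RL a phi).
Proof.
move=> a0 cphi; elim: n => [//|n IHn]; apply/funext => u.
rewrite [LHS]/= -/(iterint n _) RL_commute1//; last exact: continuous_iterint.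
by rewrite IHn.
Qed.

Lemma normr_iterint n phi (M U : R) : continuous phi ->
  (forall v, 0 < v <= U -> `|phi v| <= M) ->
  forall u, 0 < u <= U -> `|iterint n phi u| <= M * u ^+ n.
Proof.
move=> cphi h; elim: n => [|n IHn] u /andP[u0 uU].
  by rewrite expr0 mulr1 h// u0.
rewrite /= -/(iterint n _).
have M0 : 0 <= M by apply: le_trans (h u _); rewrite ?normr_ge0// u0.
have hb v : 0 < v < u -> `|iterint n phi v| <= M * u ^+ n.
  move=> /andP[v0 vu]; rewrite (le_trans (IHn v _))//.
    by rewrite v0 (le_trans (ltW vu)).
  by rewrite ler_wpM2l// lerXn2r// ?nnegrE ltW.
apply: (le_trans (normr_RL ltr01 (continuous_iterint cphi) hb)).
by rewrite divr1 ppowE ?(ltW u0)// powRr1 ?(ltW u0)// -mulrA -exprSr.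
Qed.

(** Half of the exponent a of the kernel pays for the singularity produced by
    e^(-y) <= y^(-a/2), and the other half keeps the kernel integrable. *)
Lemma normr_RL_expR a phi (l A u : R) : 0 < a <= 1 -> continuous phi ->
  0 < l -> 0 < u -> 0 <= A -> (forall v, 0 < v < u -> `|phi v| <= A * expR (l * v)) ->
  `|RL a phi u| <= A * expR (l * u) * (l `^ (- (a / 2)) * u `^ (a / 2) * (2 / a)).
Proof.
move=> /andP[a0 a1] cphi l0 u0 A0 h.
have a20 : 0 < a / 2 by rewrite divr_gt0.
rewrite /RL normrM (ger0_norm (ppow_ge0 _ _)) ppowE ?(ltW u0)//.
have -> : \int[mu]_(x in `]0, 1[) ((1 - x) `^ (a - 1) * phi (u * x)) =
   \int[mu]_(x in `]0, 1[) ((1 - x) `^ (a / 2 - 1) * ((1 - x) `^ (a / 2) * phi (u * x))).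
  apply: eq_Rintegral => x; rewrite inE/= in_itv/= => /andP[_ x1].
  rewrite mulrA -powRD; last by rewrite (gt_eqF (_ : 0 < 1 - x)) ?implybT// subr_gt0.
  by congr (_ `^ _ * _); lra.
have bnd x : 0 < x < 1 ->
    `|(1 - x) `^ (a / 2) * phi (u * x)| <= A * expR (l * u) * (l * u) `^ (- (a / 2)).
  move=> xI; have /andP[x0 x1] := xI.
  have x10 : 0 < 1 - x by rewrite subr_gt0.
  have lux : 0 < l * u * (1 - x) by rewrite !mulr_gt0.
  rewrite normrM (ger0_norm (powR_ge0 _ _)).
  apply: (@le_trans _ _ ((1 - x) `^ (a / 2) * (A * expR (l * (u * x))))).
    by rewrite ler_wpM2l ?powR_ge0// h// mulr_itvoo.
  have -> : l * (u * x) = l * u + - (l * u * (1 - x)) by ring.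
  rewrite expRD (mulrA A) mulrCA ler_wpM2l ?mulr_ge0 ?expR_ge0//.
  apply: (@le_trans _ _ ((1 - x) `^ (a / 2) * (l * u * (1 - x)) `^ (- (a / 2)))).
    rewrite ler_wpM2l ?powR_ge0// expRN_le_powRN// a20/=.
    by rewrite ler_pdivrMr//; lra.
  rewrite powRM ?(ltW x10) ?mulr_ge0 ?(ltW l0) ?(ltW u0)// mulrCA -powRD; last first.
    by rewrite (gt_eqF x10) implybT.
  by rewrite subrr powRr0 mulr1.
have mg : measurable_fun `](0 : R), 1[ (fun x => (1 - x) `^ (a / 2) * phi (u * x)).
  apply: measurable_funM; last exact: measurable_dilation.
  by apply: measurable_fun_powRl; exact: measurable_funB.
rewrite (le_trans (ler_wpM2l (powR_ge0 u a) (normr_integral_kernel a20 mg bnd)))//.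
rewrite powRM ?(ltW l0) ?(ltW u0)//.
have -> : u `^ a = u `^ (a / 2) * u `^ (a / 2).
  rewrite -powRD; last by rewrite (gt_eqF u0) implybT.
  by congr (_ `^ _); lra.
rewrite [u `^ (- _)]powRN.
have ua : u `^ (a / 2) != 0 by rewrite gt_eqF// powR_gt0.
rewrite le_eqVlt; apply/orP; left; apply/eqP.
by field; rewrite ua gt_eqF.
Qed.

Lemma normr_RL_expR_small a (q U : R) : 0 < a <= 1 -> 0 < q -> 0 < U ->
  exists2 L : R, 0 < L & forall (l : R), L <= l ->
    forall phi (A : R), continuous phi -> 0 <= A ->
    (forall v, 0 < v <= U -> `|phi v| <= A * expR (l * v)) ->
    forall u, 0 < u <= U -> `|RL a phi u| <= q * A * expR (l * u).
Proof.
move=> aI q0 U0; have /andP[a0 a1] := aI.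
have a20 : 0 < a / 2 by rewrite divr_gt0.
pose d := q / (U `^ (a / 2) * (2 / a)).
have Ua : 0 < U `^ (a / 2) * (2 / a) by rewrite mulr_gt0 ?powR_gt0// divr_gt0.
have d0 : 0 < d by rewrite divr_gt0.
have [L L0 hL] := exists_large_powRN a20 d0.
exists L => // l Ll phi A cphi A0 h u /andP[u0 uU].
have l0 : 0 < l by exact: lt_le_trans Ll.
have {}h v : 0 < v < u -> `|phi v| <= A * expR (l * v).
  by move=> /andP[v0 vu]; apply: h; rewrite v0 (le_trans (ltW vu)).
rewrite (le_trans (normr_RL_expR aI cphi l0 u0 A0 h))// mulrC -[leRHS]mulrA.
rewrite ler_wpM2r ?mulr_ge0 ?expR_ge0//.
apply: (@le_trans _ _ (d * (U `^ (a / 2) * (2 / a)))); last by rewrite divfK ?gt_eqF.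
have a2 : 0 <= 2 / a by rewrite divr_ge0 ?(ltW a0).
rewrite -mulrA ler_pM ?powR_ge0 ?hL ?(mulr_ge0 _ a2) ?powR_ge0//.
by rewrite ler_wpM2r// ge0_ler_powR ?nnegrE ?(ltW a20) ?(ltW u0) ?(ltW U0).
Qed.

Lemma normr_volterra_small a n (q U : R) : 0 < a <= 1 -> 0 < q -> 0 < U ->
  exists2 l : R, 0 < l &
    forall phi (A : R), continuous phi -> 0 <= A ->
    (forall v, 0 <= v <= U -> `|phi v| <= A * expR (l * v)) ->
    forall u, 0 <= u <= U -> `|iterint n (RL a phi) u| <= q * A * expR (l * u).
Proof.
move=> aI q0 U0; have /andP[a0 a1] := aI.
have [L1 L10 h1] := normr_RL_expR_small aI q0 U0.
have [||L2 L20 h2] := @normr_RL_expR_small 1 1 U _ _ U0; rewrite ?ltr01 ?lexx//.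
exists (Num.max L1 L2); first by rewrite lt_max L10.
set l := Num.max L1 L2 => phi A cphi A0 h u /andP[u0 uU].
have Ll1 : L1 <= l by rewrite le_max lexx.
have Ll2 : L2 <= l by rewrite le_max lexx orbT.
move: u0; rewrite le_eqVlt => /predU1P[<-|u0].
  case: n => [|n] /=; rewrite RL_le0 ?normr0 ?mulr_ge0 ?expR_ge0 ?(ltW q0)//.
have {}h v : 0 < v <= U -> `|phi v| <= A * expR (l * v).
  by move=> /andP[v0 vU]; rewrite h// vU ltW.
elim: n u u0 uU => [|n IHn] u u0 uU.
  by apply: h1 => //; rewrite u0.
rewrite /= -/(iterint n _) -[q * A]mul1r.
apply: h2 => //; [|by rewrite mulr_ge0// ltW| |by rewrite u0].
  exact/continuous_iterint/continuous_RL.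
by move=> v /andP[v0 vU]; exact: IHn.
Qed.

Lemma continuous_iterint_RL a n phi : 0 < a -> continuous phi ->
  continuous (iterint n (RL a phi)).
Proof. by move=> a0 cphi; exact/continuous_iterint/continuous_RL. Qed.

Lemma iterint_RL_sub a n phi psi u : 0 < a -> continuous phi -> continuous psi ->
  iterint n (RL a (fun v => phi v - psi v)) u =
  iterint n (RL a phi) u - iterint n (RL a psi) u.
Proof.
move=> a0 cphi cpsi; have -> : RL a (fun v => phi v - psi v) =
    (fun v => RL a phi v - RL a psi v) by apply/funext => v; rewrite RL_sub.
by rewrite iterint_sub//; exact: continuous_RL.
Qed.

Lemma RL_iterint_RL a b n phi : 0 < a -> 0 < b -> a + b = 1 -> continuous phi ->
  RL a (iterint n (RL b phi)) = (fun u => betaR a b * iterint n.+1 phi u).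
Proof.
move=> a0 b0 ab cphi; rewrite RL_iterint//; last exact: continuous_RL.
have -> : RL a (RL b phi) = (fun u => betaR a b * RL 1 phi u).
  by apply/funext => u; rewrite (RL_semigroup u a0 b0 cphi) ab.
by rewrite iterint_scale; [rewrite /iterint iterSr|exact: continuous_RL].
Qed.

(** Applying the integral of order 1 - a gives, by the semigroup law, that the
    primitive of phi vanishes. *)
Lemma RL_inj a phi (U : R) : 0 < a < 1 -> continuous phi ->
  (forall u, 0 < u < U -> RL a phi u = 0) -> forall u, 0 < u < U -> phi u = 0.
Proof.
move=> /andP[a0 a1] cphi h u /andP[u0 uU].
have b0 : 0 < 1 - a by rewrite subr_gt0.
have E v : 0 < v < U -> RL 1 phi v = 0.
  move=> /andP[v0 vU]; have := @RL_semigroup R (1 - a) a phi v b0 a0 cphi.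
  rewrite subrK => /esym/eqP.
  rewrite (eq_RL (psi := fun=> 0) b0) => [|w /andP[w0 wv]]; last first.
    by apply: h; rewrite w0 (lt_trans wv).
  rewrite [X in _ == X](_ : _ = 0); last first.
    by rewrite /RL /Rintegral integral0_eq ?mulr0// => x _; rewrite mulr0.
  by rewrite mulf_eq0 gt_eqF ?betaR_gt0//= => /eqP.
have := is_derive_RL1 u0 cphi.
have : is_derive u 1 (RL 1 phi) 0.
  apply: near_eq_is_derive (is_derive_cst 0 u 1).
  near=> v; rewrite E//; apply/andP; split.
    by near: v; exact: lt_nbhsr.
  by near: v; exact: lt_nbhsl.
by move=> [_ <-] [_ <-].
Unshelve. all: by end_near. Qed.

End volterra.

(** For a = 1 - gamma and c = [frac_cst gamma], the Riemann-Liouville integral of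
    order n + 1 - gamma with its correct normalisation. *)
Definition volterra {R : realType} (c a : R) (n : nat) (phi : R -> R) : R -> R :=
  fun u => c * iterint n (RL a phi) u.

(** * The Volterra equation *)

(** The intervals [x k - e k, x k + e k] are nested; the limit l is the supremum
    of their left endpoints. *)
Lemma telescoping_cvg {R : realType} (x e : nat -> R) :
  (forall k, 0 <= e k) -> (forall k, `|x k.+1 - x k| <= e k - e k.+1) ->
  exists l, forall k, `|l - x k| <= e k.
Proof.
move=> e0 h.
have lo j k : (j <= k)%N -> x j - e j <= x k - e k.
  elim: k => [|k IHk]; first by rewrite leqn0 => /eqP ->.
  rewrite leq_eqVlt => /predU1P[->//|/IHk]; have := h k.
  by rewrite ler_norml => /andP[? ?] ?; lra.
have up j k : (j <= k)%N -> x k + e k <= x j + e j.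
  elim: k => [|k IHk]; first by rewrite leqn0 => /eqP ->.
  rewrite leq_eqVlt => /predU1P[->//|/IHk]; have := h k.
  by rewrite ler_norml => /andP[? ?] ?; lra.
have lu j k : x j - e j <= x k + e k.
  have := lo _ _ (leq_maxl j k); have := up _ _ (leq_maxr j k).
  by have := e0 (maxn j k); lra.
pose A := range (fun k => x k - e k).
have A0 : A !=set0 by exists (x 0%N - e 0%N), 0%N.
have Aub k : ubound A (x k + e k) by move=> _ [j _ <-]; exact: lu.
exists (sup A) => k; rewrite ler_distl; apply/andP; split.
  by apply: ub_le_sup; [exists (x 0%N + e 0%N); exact: Aub|exists k].
by apply: ge_sup => //; exact: Aub.
Qed.

(** Projection onto [0, U].  Composing with it extends functions given on [0, U]
    to globally continuous ones, on which [RL] can act. *)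
Definition clamp {R : realType} (U x : R) : R := Num.max 0 (Num.min x U).

Lemma clamp_in {R : realType} (U x : R) : 0 <= U -> 0 <= clamp U x <= U.
Proof. by move=> U0; rewrite /clamp le_max lexx/= ge_max U0 ge_min lexx orbT. Qed.

Lemma clamp_id {R : realType} (U x : R) : 0 <= x <= U -> clamp U x = x.
Proof. by move=> /andP[x0 xU]; rewrite /clamp min_l// max_r. Qed.

Lemma continuous_clamp {R : realType} (U : R) : continuous (clamp U).
Proof.
move=> x; apply: (@continuous_maxf R); first exact: cst_continuous.
by apply: (@continuous_minf R); [exact: continuous_id|exact: cst_continuous].
Qed.

Section picard.
Context {R : realType}.
Variables (c a U : R) (n : nat).
Hypotheses (aI : 0 < a <= 1) (U0 : 0 < U).
Let W := volterra c a n.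
Implicit Types (phi psi y z T k : R -> R).

Let a0 : 0 < a. Proof. by case/andP: aI. Qed.

Lemma continuous_volterra phi : continuous phi -> continuous (W phi).
Proof.
move=> cphi u; apply: (@continuous_mulf R); first exact: cst_continuous.
exact: continuous_iterint_RL.
Qed.

Lemma volterra_sub phi psi u : continuous phi -> continuous psi ->
  W (fun v => phi v - psi v) u = W phi u - W psi u.
Proof. by move=> cphi cpsi; rewrite /W /volterra iterint_RL_sub// mulrBr. Qed.

(** The weight makes the integral operator a contraction with any prescribed
    ratio q, on an interval of any prescribed length. *)
Lemma normr_volterra_expR (q : R) : 0 < q ->
  exists2 l : R, 0 < l & forall phi psi (A : R),
    continuous phi -> continuous psi -> 0 <= A ->
    (forall v, 0 <= v <= U -> `|phi v - psi v| <= A * expR (l * v)) ->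
    forall u, 0 <= u <= U -> `|W phi u - W psi u| <= q * A * expR (l * u).
Proof.
move=> q0; have q'0 : 0 < q / (`|c| + 1) by rewrite divr_gt0// ltr_wpDl.
have [l l0 hl] := normr_volterra_small n aI q'0 U0.
exists l => // phi psi A cphi cpsi A0 h u uI.
rewrite -volterra_sub// /W /volterra normrM.
have cd : continuous (fun v => phi v - psi v).
  by move=> v; apply: (@continuous_subf R); [exact: cphi|exact: cpsi].
rewrite (le_trans (ler_wpM2l (normr_ge0 c) (hl _ A cd A0 h u uI)))//.
rewrite !mulrA ler_wpM2r ?expR_ge0// ler_wpM2r// ler_pdivrMr ?ltr_wpDl//.
by rewrite mulrC ler_wpM2l ?(ltW q0)// lerDl.
Qed.

(** With ratio q = 1 / (2 (L + 1)) the weighted maximum A of |y1 - y2| satisfies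
    2 (L + 1) A <= L A + e, so A <= e. *)
Lemma volterra_stability (L : R) : 0 < L ->
  exists2 C : R, 0 < C & forall T y1 y2 phi1 phi2 (e : R),
    continuous y1 -> continuous y2 -> continuous phi1 -> continuous phi2 ->
    0 <= e ->
    (forall u, 0 <= u <= U -> y1 u = T u + W phi1 u) ->
    (forall u, 0 <= u <= U -> y2 u = T u + W phi2 u) ->
    (forall u, 0 <= u <= U -> `|phi1 u - phi2 u| <= L * `|y1 u - y2 u| + e) ->
    forall u, 0 <= u <= U -> `|y1 u - y2 u| <= C * e.
Proof.
move=> L0.
pose q := (2 * (L + 1))^-1.
have q0 : 0 < q by rewrite invr_gt0 mulr_gt0// addr_gt0.
have [l l0 hl] := normr_volterra_expR q0.
exists (expR (l * U)); first exact: expR_gt0.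
move=> T y1 y2 phi1 phi2 e cy1 cy2 cphi1 cphi2 e0 hy1 hy2 hphi.
pose g u := `|y1 u - y2 u| * expR (- (l * u)).
have cg : continuous g.
  move=> u; apply: (@continuous_mulf R).
    apply: (@continuous_compf R Num.norm (fun u => y1 u - y2 u)).
      by apply: (@continuous_subf R); [exact: cy1|exact: cy2].
    exact: norm_continuous.
  apply: (@continuous_compf R expR (fun u => - (l * u))); last exact: continuous_expR.
  apply: (@continuous_oppf R); apply: (@continuous_mulf R).
    exact: cst_continuous.
  exact: continuous_id.
have [u0 u0I hmax] := @EVT_max _ g 0 U (ltW U0) (continuous_subspaceT cg).
have A0 : 0 <= g u0 by rewrite mulr_ge0// expR_ge0.
have gE u : `|y1 u - y2 u| = g u * expR (l * u).
  by rewrite /g -mulrA -expRD addNr expR0 mulr1.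
have hb v : 0 <= v <= U -> `|phi1 v - phi2 v| <= (L * g u0 + e) * expR (l * v).
  move=> vI; rewrite (le_trans (hphi v vI))// mulrDl lerD//.
    by rewrite gE mulrA ler_wpM2r ?expR_ge0// ler_wpM2l ?(ltW L0)// hmax// in_itv.
  rewrite ler_peMr// -[leLHS]expR0 ler_expR mulr_ge0 ?(ltW l0)//.
  by case/andP: vI.
have B0 : 0 <= L * g u0 + e by rewrite addr_ge0// mulr_ge0// ltW.
have hu0 : 0 <= u0 <= U by move: u0I; rewrite in_itv.
have := hl phi1 phi2 _ cphi1 cphi2 B0 hb u0 hu0.
have -> : W phi1 u0 - W phi2 u0 = y1 u0 - y2 u0 by rewrite hy1// hy2//; ring.
rewrite gE ler_pM2r ?expR_gt0// => hq.
have Ae : g u0 <= e.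
  have : 2 * (L + 1) * g u0 <= L * g u0 + e.
    by rewrite -ler_pdivlMl ?mulr_gt0// ?addr_gt0.
  by have := mulr_ge0 (ltW L0) A0; lra.
move=> u uI; rewrite gE mulrC ler_pM ?expR_ge0//.
- by rewrite mulr_ge0// expR_ge0.
- by rewrite ler_expR ler_pM2l//; case/andP: uI.
- by rewrite (le_trans _ Ae)// hmax// in_itv.
Qed.

(** Successive approximations from T: in the weighted norm the differences of
    consecutive iterates are halved.  The set S on which Phi has to be defined
    and Lipschitz is stable by hypothesis. *)
Lemma volterra_fixpoint T k (Phi : (R -> R) -> R -> R) (L : R) :
  let S y := continuous y /\ forall v, 0 <= v <= U -> `|y v - T v| <= k v in
  continuous T -> (forall v, 0 <= k v) -> 0 < L ->
  (forall y, S y -> continuous (Phi y)) ->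
  (forall y z, S y -> S z -> forall v, 0 <= v <= U ->
     `|Phi y v - Phi z v| <= L * `|y v - z v|) ->
  (forall y, S y -> forall u, 0 <= u <= U -> `|W (Phi y) u| <= k u) ->
  exists2 y, S y & forall u, 0 <= u <= U -> y u = T u + W (Phi y) u.
Proof.
move=> S cT k0 L0 cPhi LPhi WPhi.
pose q := (2 * L)^-1.
have q0 : 0 < q by rewrite invr_gt0 mulr_gt0.
have [l l0 hl] := normr_volterra_expR q0.
pose N y u := T u + W (Phi y) u.
have SN y : S y -> S (N y).
  move=> Sy; split.
    move=> u; apply: (@continuous_addf R); first exact: cT.
    by apply: continuous_volterra; exact: cPhi.
  by move=> v vI; rewrite /N addrC addKr WPhi.
have contr y z (A : R) : S y -> S z -> 0 <= A ->
    (forall v, 0 <= v <= U -> `|y v - z v| <= A * expR (l * v)) ->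
    forall u, 0 <= u <= U -> `|N y u - N z u| <= A / 2 * expR (l * u).
  move=> Sy Sz A0 h u uI.
  have -> : N y u - N z u = W (Phi y) u - W (Phi z) u by rewrite /N; ring.
  have LA0 : 0 <= L * A by rewrite mulr_ge0// ltW.
  have hv v : 0 <= v <= U -> `|Phi y v - Phi z v| <= L * A * expR (l * v).
    by move=> vI; rewrite (le_trans (LPhi _ _ Sy Sz v vI))// -mulrA ler_wpM2l ?(ltW L0)// h.
  rewrite (le_trans (hl _ _ _ (cPhi _ Sy) (cPhi _ Sz) LA0 hv u uI))//.
  rewrite ler_wpM2r ?expR_ge0// le_eqVlt; apply/orP; left; apply/eqP.
  by rewrite /q; field; rewrite gt_eqF.
have ST : S T by split=> // v _; rewrite subrr normr0.
(* e j is the geometric tail starting at j, so that e j - e j.+1 = A / 2 ^ j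
   bounds the step from Y j to Y j.+1 in the weighted norm. *)
pose Y j := iter j N T.
have SY j : S (Y j) by elim: j => [//|j IHj]; exact: SN.
have cd : continuous (fun u => N T u - T u).
  by move=> u; apply: (@continuous_subf R); [exact: (SN _ ST).1|exact: cT].
have [A [A0 hA]] := bounded_image_itv 0 U cd.
pose e j : R := A * 2 / 2 ^+ j.
have e0 j : 0 <= e j by rewrite !mulr_ge0// invr_ge0 exprn_ge0.
have eS j : e j - e j.+1 = A / 2 ^+ j.
  by rewrite /e exprS; field; rewrite expf_neq0.
have YS j u : 0 <= u <= U -> `|Y j.+1 u - Y j u| <= (e j - e j.+1) * expR (l * u).
  rewrite eS; elim: j u => [|j IHj] u uI.
    rewrite expr0 divr1 (le_trans (hA u uI))// ler_peMr// -[leLHS]expR0 ler_expR.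
    by rewrite mulr_ge0 ?(ltW l0)//; case/andP: uI.
  have -> : A / 2 ^+ j.+1 = A / 2 ^+ j / 2 by rewrite exprS; field; rewrite expf_neq0.
  apply: (contr (Y j.+1) (Y j)) => //.
  by rewrite mulr_ge0// invr_ge0 exprn_ge0.
pose B := expR (l * U).
have B0 : 0 < B by exact: expR_gt0.
have lim u : exists r : R, forall j, `|r - Y j (clamp U u)| <= e j * B.
  apply: telescoping_cvg => j; first by rewrite mulr_ge0// ltW.
  have uI := clamp_in u (ltW U0).
  rewrite (le_trans (YS j _ uI))// -mulrBl ler_wpM2l//.
    by rewrite eS mulr_ge0// invr_ge0 exprn_ge0.
  by rewrite ler_expR ler_pM2l//; case/andP: uI.
have [y hy] := choice lim.
have hyU j u : 0 <= u <= U -> `|y u - Y j u| <= e j * B.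
  by move=> uI; have := hy u j; rewrite clamp_id.
have small (d : R) : 0 < d -> exists j, e j * B < d.
  move=> d0.
  pose j := Num.truncn (A * 2 * B / d).
  exists j; rewrite /e mulrAC ltr_pdivrMr ?exprn_gt0// [ltRHS]mulrC -ltr_pdivrMr//.
  rewrite (lt_le_trans (truncnS_gt _))// -/j -natrX ler_nat.
  exact: ltn_expl.
have cy : continuous y.
  move=> u0; apply/cvgrPdist_lt => d d0.
  have d3 : 0 < d / 3 by rewrite divr_gt0.
  have [j hj] := small _ d3.
  have cYc : continuous_at u0 (fun u => Y j (clamp U u)).
    by apply: (@continuous_compf R); [exact: continuous_clamp|exact: (SY j).1].
  move/cvgrPdist_lt : cYc => /(_ _ d3); apply: filterS => u hu.
  have := hy u0 j; have := hy u j.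
  move: hu hj; rewrite !ltr_norml !ler_norml => /andP[? ?] ? /andP[? ?] /andP[? ?].
  by apply/andP; split; lra.
have Sy : S y.
  split=> // v vI; apply/ler_addgt0Pl => d d0.
  have [j hj] := small _ d0.
  have -> : y v - T v = (y v - Y j v) + (Y j v - T v) by ring.
  rewrite (le_trans (ler_normD _ _))// lerD ?((SY j).2)//.
  by rewrite (le_trans (hyU j v vI))// ltW.
exists y => // u uI.
apply/eqP; rewrite -subr_eq0 -normr_le0; apply/ler_addgt0Pl => d d0; rewrite addr0.
have BB0 : 0 < 1 + B by rewrite addr_gt0.
have [j hj] := small (d / (1 + B)) ltac:(by rewrite divr_gt0).
have hc : `|N y u - N (Y j) u| <= e j * B / 2 * expR (l * u).
  apply: contr => //; first by rewrite mulr_ge0// ltW.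
  move=> v vI; rewrite (le_trans (hyU j v vI))// ler_peMr ?mulr_ge0 ?(ltW B0)//.
  by rewrite -[leLHS]expR0 ler_expR mulr_ge0 ?(ltW l0)//; case/andP: vI.
have -> : y u - (T u + W (Phi y) u) = (y u - Y j.+1 u) - (N y u - N (Y j) u).
  by rewrite /Y /= /N; ring.
rewrite (le_trans (ler_normB _ _))//.
apply: (@le_trans _ _ (e j * B + e j * B * B)).
  rewrite lerD//.
    rewrite (le_trans (hyU _ _ uI))// ler_wpM2r ?(ltW B0)// -subr_ge0 eS.
    by rewrite mulr_ge0// invr_ge0 exprn_ge0.
  rewrite (le_trans hc)// ler_pM ?expR_ge0 ?mulr_ge0 ?(ltW B0) ?invr_ge0//.
    by rewrite ler_piMr ?mulr_ge0 ?(ltW B0)// invf_le1// ler1n.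
  by rewrite ler_expR ler_pM2l//; case/andP: uI.
rewrite -{1}[e j * B]mulr1 -mulrDr -ler_pdivlMr//.
exact: ltW.
Qed.

End picard.

(** * Values of the Gamma function *)

Section gamma_function.
Context {R : realType}.

(** The polynomial P such that - P(x) e^(-x) is a primitive of x^k e^(-x). *)
Fixpoint gamma_primitive (k : nat) (x : R) : R :=
  if k is k'.+1 then x ^+ k'.+1 + k'.+1%:R * gamma_primitive k' x else 1.

Lemma is_derive_exprn (k : nat) (x : R) :
  is_derive x 1 (fun y : R => y ^+ k) (k%:R * x ^+ k.-1).
Proof.
elim: k => [|k IHk]; first by rewrite mul0r; exact: is_derive_cst.
apply: (is_derive_ext (f := fun y => y * y ^+ k)) => [y|]; first by rewrite exprS.
apply: is_derive_eq (is_derive_mulf (is_derive_id x 1) IHk) _.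
by case: k {IHk} => [|k] /=; rewrite ?expr0 ?exprS -?natr1; ring.
Qed.

Lemma is_derive_gamma_primitive (k : nat) (x : R) :
  is_derive x 1 (gamma_primitive k) (gamma_primitive k x - x ^+ k).
Proof.
elim: k => [|k IHk].
  by rewrite expr0 subrr; exact: is_derive_cst.
have dX := is_derive_exprn k.+1 x.
apply: is_derive_eq (is_derive_addf dX (is_derive_scalef k.+1%:R IHk)) _.
by rewrite /=; ring.
Qed.

Lemma exprn_le_expR_half (k : nat) (x : R) : 0 <= x ->
  x ^+ k <= (2 * k%:R) ^+ k * expR (x / 2).
Proof.
move=> x0; case: k => [|k].
  rewrite !expr0 mul1r -[leLHS]expR0 ler_expR divr_ge0//.
have k0 : 0 < 2 * k.+1%:R :> R by rewrite mulr_gt0// ltr0n.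
have -> : expR (x / 2) = expR (x / (2 * k.+1%:R)) ^+ k.+1.
  by rewrite -expRM_natr; congr expR; rewrite invfM mulrA divfK// pnatr_eq0.
rewrite -exprMn lerXn2r ?nnegrE ?mulr_ge0 ?expR_ge0 ?(ltW k0)//.
rewrite mulrC -ler_pdivrMr// (le_trans _ (expR_ge1Dx _))//.
by rewrite lerDr.
Qed.

Lemma cvg_exprn_expRN (k : nat) : x ^+ k * expR (- x) @[x --> +oo] --> (0 : R).
Proof.
have h : (2 * k%:R) ^+ k * expR (- (x / 2)) @[x --> +oo] --> (0 : R).
  rewrite -[X in _ --> X](mulr0 ((2 * k%:R) ^+ k)); apply: cvgM; first exact: cvg_cst.
  apply: (@cvg_comp _ _ _ (fun x : R => x / 2) (fun z : R => expR (- z)) _ (pinfty_nbhs R)).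
    by apply: gt0_cvgMly => //; exact: cvg_id.
  exact: cvgr_expR.
apply: (squeeze_cvgr _ (cvg_cst 0) h); near=> x.
have x0 : 0 <= x by near: x; exact: nbhs_pinfty_ge.
rewrite mulr_ge0 ?exprn_ge0 ?expR_ge0//=.
have -> : expR (- x) = expR (- (x / 2)) * expR (- (x / 2)).
  by rewrite -expRD; congr expR; lra.
rewrite mulrA ler_wpM2r ?expR_ge0// expRN ler_pdivrMr ?expR_gt0//.
exact: exprn_le_expR_half.
Unshelve. all: by end_near. Qed.

Lemma cvg_gamma_primitive k : gamma_primitive k x * expR (- x) @[x --> +oo] --> (0 : R).
Proof.
elim: k => [|k IHk].
  have := cvg_exprn_expRN 0; apply: cvg_trans; apply: near_eq_cvg.
  by near=> x; rewrite expr0.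
rewrite -[X in _ --> X](_ : 0 + k.+1%:R * 0 = 0); last by rewrite mulr0 addr0.
have -> : (fun x => gamma_primitive k.+1 x * expR (- x)) =
    (fun x => x ^+ k.+1 * expR (- x) + k.+1%:R * (gamma_primitive k x * expR (- x))).
  by apply/funext => x /=; ring.
apply: cvgD; first exact: cvg_exprn_expRN.
by apply: cvgM => //; exact: cvg_cst.
Unshelve. all: by end_near. Qed.

Lemma gamma_primitive0 k : gamma_primitive k 0 = k`!%:R.
Proof. by elim: k => [//|k IHk] /=; rewrite IHk expr0n/= add0r factS natrM. Qed.

Lemma integral_exprn_expRN (k : nat) :
  (\int[mu]_(x in `[0%R, +oo[) (x ^+ k * expR (- x))%:E = (k`!%:R : R)%:E)%E.
Proof.
have dF (x : R) : is_derive x 1 (fun x => - (gamma_primitive k x * expR (- x)))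
    (x ^+ k * expR (- x)).
  have dE : is_derive x 1 (fun x : R => expR (- x)) (expR (- x) * -1).
    by apply: (@is_derive_compf R expR (fun y => - y)).
  apply: is_derive_eq (is_deriveN (is_derive_mulf (is_derive_gamma_primitive k x) dE)) _.
  by ring.
rewrite (@ge0_continuous_FTC2y _ _ (fun x => - (gamma_primitive k x * expR (- x))) _ 0).
- by rewrite gamma_primitive0 oppr0 expR0 mulr1 EFinN oppeK add0e.
- by move=> x x0; rewrite mulr_ge0 ?exprn_ge0 ?expR_ge0.
- apply: continuous_subspaceT => x; apply: (@continuous_mulf R).
    exact: exprn_continuous.
  apply: (@continuous_compf R expR (fun y => - y)); last exact: continuous_expR.
  by apply: (@continuous_oppf R); exact: continuous_id.
- by rewrite -oppr0; apply: cvgN; exact: cvg_gamma_primitive.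
- by move=> x _; case: (dF x).
- by apply/cvg_at_right_filter; exact: is_derive_continuous (dF 0).
- by move=> x _; rewrite derive1E; case: (dF x).
Qed.

Lemma Gamma_nat (k : nat) : Gamma k.+1%:R = k`!%:R :> R.
Proof.
rewrite /Gamma -[RHS]/(fine (k`!%:R%:E)) -integral_exprn_expRN /Rintegral.
congr fine; rewrite -integral_itv_obnd_cbnd.
  apply: eq_integral => x; rewrite inE/= in_itv/= andbT => x0.
  by rewrite -natr1 addrK powR_mulrn ?ltW.
apply/measurable_EFinP; apply: measurable_funM.
  by apply: measurable_funX.
by apply: measurableT_comp => //; exact: measurableT_comp.
Qed.

(** The integrand is positive, but the real-valued integral would be 0 if the
    integral were infinite.  Finiteness: x^(a-1) dominates the integrand on ]0, 1[ and
    e^(-x) on [1, +oo[. *)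
Lemma Gamma_gt0 (a : R) : 0 < a <= 1 -> 0 < Gamma a.
Proof.
move=> /andP[a0 a1].
pose g (x : R) := x `^ (a - 1) * expR (- x).
have mE (D : set R) : measurable_fun D (fun x : R => expR (- x)).
  by apply: measurableT_comp => //; exact: measurableT_comp.
have mg (D : set R) : measurable_fun D g.
  by apply: measurable_funM => //; exact: measurable_fun_powRl.
have g0 x : (0 <= (g x)%:E)%E by rewrite lee_fin mulr_ge0 ?powR_ge0 ?expR_ge0.
have mgE (D : set R) : measurable_fun D (EFin \o g) by exact/measurable_EFinP.
have pos : (0 < \int[mu]_(x in `]0%R, 1%R[) (g x)%:E)%E.
  apply: integral_itv_gt0 => // x /andP[x0 _].
  by rewrite mulr_gt0 ?powR_gt0 ?expR_gt0.
rewrite fine_gt0//; apply/andP; split.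
  apply: (lt_le_trans pos); apply: ge0_subset_integral => //.
    exact: mgE.
  by move=> x /=; rewrite !in_itv/= => /andP[-> _].
have -> : `]0, +oo[%classic = `]0, 1[ `|` `[1, +oo[ :> set R.
  by rewrite -itv_bndbnd_setU// bnd_simp.
rewrite ge0_integral_setU//=; last first.
  rewrite disj_set2E; apply/eqP/seteqP; split => // x [] /=.
  by rewrite !in_itv/= andbT => /andP[_ x1]; rewrite leNgt x1.
- by move=> x _; exact: g0.
- exact: mgE.
rewrite lte_add_pinfty//.
  apply: (@le_lt_trans _ _ (\int[mu]_(x in `]0%R, 1%R[) (x `^ (a - 1))%:E)%E).
    apply: ge0_le_integral => //.
    - by move=> x _; exact: g0.
    - exact: mgE.
    - by apply/measurable_EFinP; exact: measurable_fun_powRl.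
    move=> x /=; rewrite in_itv/= => /andP[x0 _]; rewrite lee_fin.
    rewrite ler_piMr ?powR_ge0// -[leRHS]expR0 ler_expR lerNl oppr0 ltW//.
  by rewrite ge0_integral_powR// ltry.
apply: (@le_lt_trans _ _ (\int[mu]_(x in `[0%R, +oo[) (x ^+ 0 * expR (- x))%:E)%E).
  have mE0 (D : set R) : measurable_fun D (fun x : R => (x ^+ 0 * expR (- x))%:E).
    by apply/measurable_EFinP; apply: measurable_funM.
  apply: (@le_trans _ _ (\int[mu]_(x in `[1%R, +oo[) (x ^+ 0 * expR (- x))%:E)%E).
    apply: ge0_le_integral => //.
    - by move=> x _; exact: g0.
    - exact: mgE.
    - exact: mE0.
    move=> x /=; rewrite in_itv/= andbT => x1; rewrite lee_fin expr0 ler_wpM2r ?expR_ge0//.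
    rewrite -[leRHS](powRr0 x) ler_powR//.
    by rewrite subr_le0.
  apply: ge0_subset_integral => //.
    exact: mE0.
    by move=> x _; rewrite lee_fin expr0 mul1r expR_ge0.
  by apply: subset_itvr; rewrite bnd_simp.
by rewrite integral_exprn_expRN ltry.
Qed.

End gamma_function.

(** * Derivatives relative to an interval *)

Section derivative_within.
Context {R : realType}.
Implicit Types (g Z : R -> R) (t h d : R).

Lemma within_itv_proper t h : 0 < t <= h ->
  ProperFilter (within `]0, h] t^').
Proof.
move=> /andP[t0 th]; split; last exact: within_filter.
move=> H; have : nbhs t [set s | s != t -> `]0, h]%classic s -> False] by exact: H.
move=> /nbhs_ballP[e /= e0 sub].
pose s := t - Num.min (e / 2) (t / 2).
have m0 : 0 < Num.min (e / 2) (t / 2) by rewrite lt_min !divr_gt0.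
have me : Num.min (e / 2) (t / 2) <= e / 2 by rewrite ge_min lexx.
have mt : Num.min (e / 2) (t / 2) <= t / 2 by rewrite ge_min lexx orbT.
apply: (sub s).
- rewrite /ball /= /s opprB addrC subrK gtr0_norm//.
  by rewrite (le_lt_trans me)// ltr_pdivrMr// ltr_pMr// ltr1n.
- by apply/eqP; rewrite /s; lra.
- by rewrite /= in_itv/= /s; apply/andP; split; lra.
Qed.

Lemma cvg_within_of_is_derive (D : set R) g t d : is_derive t 1 g d ->
  (g s - g t) / (s - t) @[s --> within D t^'] --> d.
Proof.
move=> /is_derive1_caratheodory[q [qE cq qt]].
have hq : q s @[s --> within D t^'] --> d.
  rewrite -qt; apply: cvg_trans (cq : q @ t --> q t).
  by apply: cvg_fmap2; apply: cvg_trans (cvg_within _) _; exact: cvg_within.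
apply: cvg_trans hq; apply: near_eq_cvg.
rewrite near_withinE; near=> s; move=> _.
rewrite qE mulfK// subr_eq0.
by near: s; rewrite near_withinE; near=> s.
Unshelve. all: by end_near. Qed.

Lemma derive_within_is_derive t h g d : 0 < t <= h -> is_derive t 1 g d ->
  derivable_within `]0, h] g t /\ derive_within `]0, h] g t = d.
Proof.
move=> th dg; have hc := @cvg_within_of_is_derive `]0, h] g t d dg.
split; first by apply/cvg_ex; exists d.
have := within_itv_proper th => PF.
exact: cvg_lim.
Qed.

(** At an interior point the relative derivative is the two-sided one.  At the
    right end h this fails, and for this reason the uniqueness argument works on
    the open interval. *)
Lemma is_derive_derive_within t h g : 0 < t < h ->
  derivable_within `]0, h] g t -> is_derive t 1 g (derive_within `]0, h] g t).
Proof.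
move=> /andP[t0 th] dg.
set d := derive_within _ _ _.
have hd : (g s - g t) / (s - t) @[s --> within `]0, h] t^'] --> d by exact: dg.
apply/is_derive1_caratheodory.
exists (fun s => if s == t then d else (g s - g t) / (s - t)); split.
- move=> z; case: eqP => [->|/eqP zt]; first by rewrite !subrr mulr0.
  by rewrite divfK// subr_eq0.
- apply/cvgrPdist_lt => e e0; rewrite eqxx.
  move/cvgrPdist_lt : hd => /(_ e e0); rewrite !near_withinE => hd.
  near=> s; case: eqP => [_|/eqP st]; first by rewrite subrr normr0.
  have : s != t -> `]0, h]%classic s -> `|d - (g s - g t) / (s - t)| < e.
    by near: s.
  apply => //; rewrite /= in_itv/=; apply/andP; split.
    by near: s; exact: lt_nbhsr.
  by apply: ltW; near: s; exact: lt_nbhsl.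
- by rewrite eqxx.
Unshelve. all: by end_near. Qed.

Lemma eq_derivative_within (D : set R) g1 g2 t :
  (forall s, D s -> g1 s = g2 s) -> D t ->
  derivable_within D g1 t = derivable_within D g2 t /\
  derive_within D g1 t = derive_within D g2 t.
Proof.
move=> g12 Dt.
have E : (g1 s - g1 t) / (s - t) @[s --> within D t^'] =
         (g2 s - g2 t) / (s - t) @[s --> within D t^'].
  rewrite eqEsubset; split; apply: near_eq_cvg; rewrite near_withinE;
  by near=> s; move=> Ds; rewrite !g12.
by rewrite /derivable_within /derive_within E.
Unshelve. all: by end_near. Qed.

End derivative_within.

(** * Conjugation to the variable u = t^rho *)

Definition subst_pull {R : realType} (sigma rho : R) (Z : R -> R) (t : R) : R :=
  expR (- sigma * t `^ rho) * Z (t `^ rho).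

Definition subst_push {R : realType} (sigma rho : R) (g : R -> R) (u : R) : R :=
  expR (sigma * u) * g (u `^ rho^-1).

Lemma powR_invl {R : realType} (y c : R) : 0 < y -> y^-1 `^ c = (y `^ c)^-1.
Proof.
move=> y0; have yc : y `^ c != 0 by rewrite gt_eqF// powR_gt0.
rewrite -[LHS](mulfK yc) -powRM ?invr_ge0 ?ltW//.
by rewrite mulVf ?gt_eqF// powR1 mul1r.
Qed.

Section conjugation.
Context {R : realType}.
Variables (sigma rho h : R).
Hypotheses (rho0 : 0 < rho).
Implicit Types (g Z w : R -> R) (t u d : R).

Let pull := subst_pull sigma rho.
Let push := subst_push sigma rho.
Let D : set R := `]0, h].

Lemma powR_rhoK t : 0 <= t -> (t `^ rho) `^ rho^-1 = t.
Proof. by move=> t0; rewrite -powRrM mulfV ?gt_eqF// powRr1. Qed.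

Lemma powR_rhoVK u : 0 <= u -> (u `^ rho^-1) `^ rho = u.
Proof. by move=> u0; rewrite -powRrM mulVf ?gt_eqF// powRr1. Qed.

Lemma is_derive_pull Z t d : 0 < t -> is_derive (t `^ rho) 1 Z d ->
  is_derive t 1 (pull Z) (rho * t `^ (rho - 1) *
    (expR (- sigma * t `^ rho) * d - sigma * pull Z t)).
Proof.
move=> t0 dZ.
have dp := is_derive1_powR rho t0.
have dE : is_derive t 1 (fun s => expR (- sigma * s `^ rho))
    (expR (- sigma * t `^ rho) * (- sigma * (rho * t `^ (rho - 1)))).
  by apply: (@is_derive_compf R expR (fun s => - sigma * s `^ rho)).
have dZp := @is_derive_compf R Z (fun s => s `^ rho) t d _ dZ dp.
apply: is_derive_eq (is_derive_mulf dE dZp) _.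
by rewrite /pull /subst_pull; ring.
Qed.

(** The factor t^(1-rho) / rho cancels the derivative of t^rho, and the term
    sigma g cancels the derivative of the exponential. *)
Lemma substD1_pull g Z t d : 0 < t <= h -> (forall s, 0 < s <= h -> g s = pull Z s) ->
  is_derive (t `^ rho) 1 Z d ->
  derivable_within D g t /\
  substD1 D sigma rho g t = expR (- sigma * t `^ rho) * d.
Proof.
move=> th gZ dZ; have /andP[t0 _] := th.
have [dW dWE] := derive_within_is_derive th (is_derive_pull t0 dZ).
have [|e1 e2] := @eq_derivative_within R D g (pull Z) t _ th.
  by move=> s; rewrite /D/= in_itv/=; exact: gZ.
split; first by rewrite e1.
rewrite /substD1 e2 dWE gZ//.
have -> : t `^ (1 - rho) = (t `^ (rho - 1))^-1 by rewrite -powRN; congr (_ `^ _); ring.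
by field; rewrite !gt_eqF// powR_gt0.
Qed.

(** The converse of [substD1_pull], from a function of t to one of u, at interior
    points. *)
Lemma is_derive_push g t : 0 < t < h -> derivable_within D g t ->
  is_derive (t `^ rho) 1 (push g)
    (expR (sigma * t `^ rho) * substD1 D sigma rho g t).
Proof.
move=> th; have /andP[t0 _] := th => /(is_derive_derive_within th) dg.
have p0 : 0 < t `^ rho by rewrite powR_gt0.
have dp := is_derive1_powR rho^-1 p0.
have dE : is_derive (t `^ rho) 1 (fun u => expR (sigma * u))
    (expR (sigma * t `^ rho) * (sigma * 1)).
  by apply: (@is_derive_compf R expR (fun s => sigma * s)).
rewrite -[in X in is_derive X _ g _](powR_rhoK (ltW t0)) in dg.
have dgp := @is_derive_compf R g (fun u => u `^ rho^-1) _ _ _ dg dp.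
apply: is_derive_eq (is_derive_mulf dE dgp) _.
rewrite powR_rhoK ?(ltW t0)// /substD1.
have -> : (t `^ rho) `^ (rho^-1 - 1) = t `^ (1 - rho).
  by rewrite -powRrM; congr (_ `^ _); field; rewrite gt_eqF.
by field; rewrite gt_eqF.
Qed.

Lemma substD_pull_chain n g (Z : nat -> R -> R) :
  (forall s, 0 < s <= h -> g s = pull (Z 0%N) s) ->
  (forall j u, (j < n)%N -> 0 < u -> is_derive u 1 (Z j) (Z j.+1 u)) ->
  (forall j t, (j <= n)%N -> 0 < t <= h -> substD D sigma rho j g t = pull (Z j) t) /\
  (forall t, 0 < t <= h -> substD_exists D sigma rho n g t).
Proof.
move=> g0 dZ.
have E j t : (j <= n)%N -> 0 < t <= h -> substD D sigma rho j g t = pull (Z j) t.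
  elim: j t => [|j IHj] t jn th; first exact: g0.
  have p0 : 0 < t `^ rho by rewrite powR_gt0//; case/andP: th.
  have := substD1_pull th _ (dZ j _ jn p0).
  by move=> /(_ (substD D sigma rho j g))[s sI|_ E]; [rewrite IHj// ltnW|exact: E].
split=> // t th j jn.
have p0 : 0 < t `^ rho by rewrite powR_gt0//; case/andP: th.
have [|//] := @substD1_pull (substD D sigma rho j g) _ _ _ th _ (dZ j _ jn p0).
by move=> s sI; rewrite E// ltnW.
Qed.

Lemma push_chain n g (e : R) : 0 < e <= h ->
  (forall t, 0 < t < e -> substD_exists D sigma rho n g t) ->
  forall j u, (j < n)%N -> 0 < u < e `^ rho ->
  is_derive u 1 (push (substD D sigma rho j g)) (push (substD D sigma rho j.+1 g) u).
Proof.
move=> /andP[e0 eh] ex j u jn /andP[u0 ue].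
pose t := u `^ rho^-1.
have t0 : 0 < t by rewrite powR_gt0.
have ut : u = t `^ rho by rewrite powR_rhoVK ?ltW.
have te : t < e.
  rewrite -[ltRHS](powR_rhoK (ltW e0)) gt0_ltr_powR ?invr_gt0 ?nnegrE ?powR_ge0//.
  exact: ltW.
have exj := ex t; rewrite t0 te in exj; have dj := exj isT j jn.
have := is_derive_push _ dj; rewrite t0 (lt_le_trans te eh) => /(_ isT).
rewrite -ut => du; apply: is_derive_eq du _.
by rewrite /push /subst_push -/t.
Qed.

(** Substitution x = (s / t)^rho: the exponentials combine to e^(-sigma t^rho),
    and the powers of t^rho to the scaling factor of [RL]. *)
Lemma substI_pull (gam : R) g w t : 0 < gam -> 0 < t -> continuous w ->
  (forall s, 0 < s < t -> g s = pull w s) ->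
  mu.-integrable `[0, t] (EFin \o substI_integrand sigma rho gam g t) /\
  rho * \int[mu]_(s in `[0, t]) substI_integrand sigma rho gam g t s =
    expR (- sigma * t `^ rho) * RL gam w (t `^ rho).
Proof.
move=> gam0 t0 cw gw.
have p0 : 0 < t `^ rho by rewrite powR_gt0.
pose p s := ppow rho s / t `^ rho.
pose q s := rho * s `^ (rho - 1) / t `^ rho.
pose G x := (1 - x) `^ (gam - 1) * w (t `^ rho * x).
(* p is the substitution, q its derivative and K the constant left over. *)
pose K := expR (- sigma * t `^ rho) * (t `^ rho) `^ gam / rho.
have K0 : 0 < K by rewrite divr_gt0// mulr_gt0 ?expR_gt0 ?powR_gt0.
have pt0 : p 0 = 0 by rewrite /p ppow_le0// mul0r.
have ptt : p t = 1 by rewrite /p ppowE ?(ltW t0)// divff ?gt_eqF.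
have IE s : 0 < s < t -> substI_integrand sigma rho gam g t s = K * (G (p s) * q s).
  move=> /andP[s0 st]; rewrite /substI_integrand gw ?s0// /pull /subst_pull.
  have sp : s `^ rho < t `^ rho by rewrite gt0_ltr_powR ?nnegrE ?ltW.
  rewrite /G /p /q ppowE ?(ltW s0)//.
  have -> : t `^ rho * (s `^ rho / t `^ rho) = s `^ rho by field; rewrite gt_eqF.
  have -> : 1 - s `^ rho / t `^ rho = (t `^ rho - s `^ rho) * (t `^ rho)^-1.
    by field; rewrite gt_eqF.
  rewrite powRM ?subr_ge0 ?(ltW sp) ?invr_ge0 ?(ltW p0)//.
  have -> : expR (- sigma * (t `^ rho - s `^ rho)) =
      expR (- sigma * t `^ rho) * expR (sigma * s `^ rho).
    by rewrite -expRD; congr expR; ring.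
  have -> : expR (- sigma * s `^ rho) = (expR (sigma * s `^ rho))^-1.
    by rewrite -expRN mulNr.
  rewrite /K -{1}(mulr_powRB1 (ltW p0) gam0).
  have -> : (t `^ rho)^-1 `^ (gam - 1) = ((t `^ rho) `^ (gam - 1))^-1.
    exact: powR_invl.
  field; rewrite !gt_eqF ?expR_gt0 ?powR_gt0//.
have cG (y : R) : 0 < y < 1 -> continuous_at y G.
  move=> /andP[_ y1]; apply: (@continuous_mulf R); first exact: continuous_onem_powR.
  apply: (@continuous_compf R w (fun x => t `^ rho * x)); last exact: cw.
  by apply: (@continuous_mulf R); [exact: cst_continuous|exact: continuous_id].
have iG : mu.-integrable `]0, 1[ (EFin \o G) by exact: integrable_RL.
have cp : continuous p.
  move=> s; apply: (@continuous_mulf R); last exact: cst_continuous.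
  exact: continuous_ppow.
have dp s : s \in `]0, t[ -> is_derive s 1 p (q s).
  rewrite in_itv/= => /andP[s0 _].
  apply: is_derive_eq (is_derive_mulf (is_derive_ppow rho s0) (is_derive_cst _ _ _)) _.
  by rewrite mulr0 addr0.
have cq (s : R) : s \in `]0, t[ -> continuous_at s q.
  rewrite in_itv/= => /andP[s0 _].
  apply: (@continuous_mulf R); last exact: cst_continuous.
  by apply: (@continuous_mulf R); [exact: cst_continuous|exact: continuous_powR].
have q0 s : s \in `]0, t[ -> 0 < q s.
  by rewrite in_itv/= => /andP[s0 _]; rewrite divr_gt0// mulr_gt0// powR_gt0.
have pI s : 0 < s < t -> 0 < p s < 1.
  move=> /andP[s0 st]; rewrite /p ppowE ?(ltW s0)// divr_gt0 ?powR_gt0//=.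
  by rewrite ltr_pdivrMr// mul1r gt0_ltr_powR ?nnegrE ?ltW.
have iGq : mu.-integrable `]0, t[ (EFin \o (fun s => G (p s) * q s)).
  apply/integrableP; split.
    apply/measurable_EFinP; apply: measurable_itv_continuous => s sI.
    apply: (@continuous_mulf R); last exact: cq.
    apply: (@continuous_compf R G p); first exact: cp.
    by apply: cG; apply: pI; rewrite in_itv in sI.
  have := @ge0_integral_subst_oo R p q (fun x => `|G x|) 0 t t0
     (continuous_subspaceT cp) dp cq q0.
  rewrite pt0 ptt => subst.
  rewrite [ltLHS](_ : _ = \int[mu]_(s in `]0%R, t[) (`|G (p s)| * q s)%:E)%E; last first.
    apply: eq_integral => s; rewrite inE/= => sI.
    by rewrite normrM (gtr0_norm (q0 _ sI)).
  rewrite -subst.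
  - by have /integrableP[_] := iG.
  - move=> y; rewrite in_itv/= => yI.
    by apply: (@continuous_compf R Num.norm G); [exact: cG|exact: norm_continuous].
  - by [].
have iS : mu.-integrable `]0, t[ (EFin \o substI_integrand sigma rho gam g t).
  have : mu.-integrable `]0, t[ (fun s => K%:E * (G (p s) * q s)%:E)%E.
    exact: integrableZl.
  apply: eq_integrable => // s; rewrite inE/= in_itv/= => sI.
  by rewrite IE.
have mS := measurable_int _ iS.
split.
  apply/integrableP; split.
    exact: emeasurable_fun_itv_cc mS.
  rewrite -integral_itv_bndo_bndc; last first.
    apply: measurableT_comp => //; exact/emeasurable_fun_itv_obnd_cbndP.
  rewrite -integral_itv_obnd_cbnd; last exact: measurableT_comp.
  by have /integrableP[_] := iS.
rewrite -Rintegral_itv_bndo_bndc; last first.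
  apply/integrableP; split; first exact/emeasurable_fun_itv_obnd_cbndP.
  rewrite -integral_itv_obnd_cbnd; last exact: measurableT_comp.
  by have /integrableP[_] := iS.
rewrite -Rintegral_itv_obnd_cbnd//.
rewrite (@eq_Rintegral _ _ _ mu _ (fun s => K * (G (p s) * q s))); last first.
  by move=> s; rewrite inE/= in_itv/= => sI; rewrite IE.
rewrite RintegralZl//.
have := @integral_subst_oo R p q G 0 t t0 (continuous_subspaceT cp) dp cq q0.
rewrite pt0 ptt => subst; rewrite /Rintegral -subst; last first.
  by move=> y; rewrite in_itv/=; exact: cG.
rewrite /RL ppowE ?(ltW p0)// /K /Rintegral.
by field; rewrite gt_eqF.
Qed.

End conjugation.

(** * Polynomials and Taylor estimates at 0 *)

Section taylor.
Context {R : realType}.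
Implicit Types (f df : R -> R) (p q : {poly R}) (U u e : R).

Lemma is_derive_horner p (x : R) : is_derive x 1 (horner p) (deriv p).[x].
Proof.
split; first exact: derivable_horner.
by rewrite -derive1E -derivE.
Qed.

Lemma continuous_horner p : continuous (horner p).
Proof. by move=> x; exact: is_derive_continuous (is_derive_horner p x). Qed.

Lemma MVT_closed f df (x y : R) : x <= y ->
  (forall z, x <= z <= y -> is_derive z 1 f (df z)) ->
  exists2 c, x <= c <= y & f y - f x = df c * (y - x).
Proof.
move=> xy dI.
have dd z : z \in `]x, y[ -> is_derive z 1 f (df z).
  by move=> /subset_itv_oo_cc; rewrite in_itv/=; exact: dI.
have cf : {within `[x, y], continuous f}.
  by apply: derivable_within_continuous => z; rewrite in_itv/= => /dI[].
by have [c cI E] := @MVT_segment R f df x y xy dd cf; exists c.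
Qed.

Lemma derive0_oo f U : (forall u, 0 < u < U -> is_derive u 1 f 0) ->
  forall x y, 0 < x < U -> 0 < y < U -> f x = f y.
Proof.
move=> df x y; wlog xy : x y / x <= y => [H xI yI|].
  by case: (leP x y) => [/H->//|/ltW/H->].
move=> /andP[x0 xU] /andP[y0 yU].
have d z : x <= z <= y -> is_derive z 1 f 0.
  by move=> /andP[xz zy]; apply: df; rewrite (lt_le_trans x0) ?(le_lt_trans zy).
have [c _] := MVT_closed xy d.
by rewrite mul0r => /eqP; rewrite subr_eq0 => /eqP ->.
Qed.

Definition primitive_poly (n : nat) p : {poly R} :=
  \poly_(i < n.+1) (p`_i.-1 / i%:R).

Lemma deriv_primitive_poly n p : (size p <= n)%N -> deriv (primitive_poly n p) = p.
Proof.
move=> pn; apply/polyP => i; rewrite coef_deriv coef_poly.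
case: ltnP => [_|ni] /=.
  by rewrite -[LHS]mulr_natr divfK// pnatr_eq0.
by rewrite mul0rn nth_default// (leq_trans pn).
Qed.

Lemma derive_chain0_poly (m : nat) (E : nat -> R -> R) U : 0 < U ->
  (forall j u, (j < m)%N -> 0 < u < U -> is_derive u 1 (E j) (E j.+1 u)) ->
  (forall u, 0 < u < U -> E m u = 0) ->
  exists2 p : {poly R}, (size p <= m)%N & forall u, 0 < u < U -> E 0%N u = p.[u].
Proof.
move=> U0; elim: m E => [|m IHm] E dE E0.
  by exists 0 => [|u uI]; rewrite ?size_poly0// E0// horner0.
have [||q qm Eq] := IHm (fun j => E j.+1); [by move=> j u jm; exact: dE|by []|].
pose Q := primitive_poly m q.
have U2 : 0 < U / 2 < U by apply/andP; split; lra.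
exists (Q + (E 0%N (U / 2) - Q.[U / 2])%:P).
  rewrite (leq_trans (size_polyD _ _))// geq_max size_poly/=.
  by rewrite (leq_trans (size_polyC_leq1 _)).
move=> u uI; rewrite hornerD hornerC.
have dd v : 0 < v < U -> is_derive v 1 (fun z => E 0%N z - Q.[z]) 0.
  move=> vI; apply: is_derive_eq
    (is_derive_subf (dE 0%N v (ltn0Sn _) vI) (is_derive_horner Q v)) _.
  by rewrite Eq// deriv_primitive_poly// subrr.
have := derive0_oo dd uI U2; lra.
Qed.

(** The constant term must vanish; then divide by u and induct on n. *)
Lemma poly_eq0_littleo (n : nat) p : (size p <= n.+1)%N ->
  (forall e, 0 < e -> exists2 d : R, 0 < d &
     forall u, 0 < u < d -> `|p.[u]| <= e * u ^+ n) -> p = 0.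
Proof.
elim: n p => [|n IHn] p.
  move=> /size1_polyC -> h; set c := p`_0.
  suff -> : c = 0 by rewrite polyC0.
  apply/eqP; rewrite -normr_le0; apply/ler_addgt0Pl => e e0; rewrite addr0.
  have [d d0 hd] := h e e0; have := hd (d / 2).
  by rewrite hornerC expr0 mulr1; apply; apply/andP; split; lra.
elim/poly_ind: p => [//|q c _] sp h.
have c0 : c = 0.
  have [M [M0 hM]] := bounded_image_itv 0 1 (@continuous_horner q).
  apply/eqP; rewrite -normr_le0; apply/ler_addgt0Pl => e e0; rewrite addr0.
  have [d d0 hd] := h 1 ltr01.
  (* Small enough for u ^+ n.+1 + M * u to be at most e. *)
  pose u := Num.min (d / 2) (Num.min 1 (e / (M + 1))).
  have MM : 0 < M + 1 by rewrite ltr_wpDl.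
  have eM : 0 < e / (M + 1) by rewrite divr_gt0.
  have u0 : 0 < u by rewrite !lt_min divr_gt0//= ltr01.
  have ud : u <= d / 2 by rewrite ge_min lexx.
  have u1 : u <= 1 by rewrite !ge_min lexx orbT.
  have ue : u <= e / (M + 1) by rewrite !ge_min lexx !orbT.
  have := hd u; rewrite u0/= hornerMXaddC mul1r => /(_ _) hu.
  have {}hu : `|q.[u] * u + c| <= u ^+ n.+1 by apply: hu; lra.
  have -> : c = (q.[u] * u + c) - q.[u] * u by ring.
  rewrite (le_trans (ler_normB _ _))// (@le_trans _ _ (u + M * u))//.
    rewrite lerD//; first by rewrite (le_trans hu)// exprS ler_piMr ?exprn_ile1 ?(ltW u0).
    by rewrite normrM (gtr0_norm u0) ler_wpM2r ?(ltW u0)// hM// (ltW u0).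
  by rewrite -[X in X + _]mul1r -mulrDl mulrC addrC -ler_pdivlMr.
move: sp h; rewrite c0 addr0 => sp h.
have [->|q0] := eqVneq q 0; first by rewrite mul0r.
rewrite (IHn q) ?mul0r//; first by rewrite size_mulX in sp.
move=> e e0; have [d d0 hd] := h e e0; exists d => // u uI.
have /andP[u0 _] := uI; have := hd u uI.
by rewrite hornerMX normrM (gtr0_norm u0) exprSr mulrA ler_pM2r.
Qed.

(** The derivative is not assumed to exist at 0, so the mean value theorem is
    applied on [s, u] with s small enough to make f s negligible. *)
Lemma mean_value_bound (i : nat) f df (e d : R) :
  (forall u, 0 < u < d -> is_derive u 1 f (df u)) ->
  (forall u, 0 < u < d -> `|df u| <= e * u ^+ i) ->
  f u @[u --> 0^'+] --> 0 ->
  forall u, 0 < u < d -> `|f u| <= e * u ^+ i.+1.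
Proof.
move=> dfE dfb f0 u /andP[u0 ud]; apply/ler_addgt0Pl => r r0.
have e0 : 0 <= e.
  have := dfb u; rewrite u0 ud => /(_ isT) /(le_trans (normr_ge0 _)).
  by rewrite pmulr_lge0// exprn_gt0.
have [s [s0 su fs]] : exists s, [/\ 0 < s, s < u & `|f s| <= r].
  have : \forall s \near 0^'+, [/\ 0 < s, s < u & `|f s| <= r].
    near=> s; split; near: s.
    - exact: nbhs_right_gt.
    - exact: nbhs_right_lt.
    - move/cvgrPdist_le : f0 => /(_ r r0); apply: filterS => s.
      by rewrite sub0r normrN.
  by move=> /(@filter_ex _ _ (at_right_proper_filter (0 : R))).
have -> : f u = f s + (f u - f s) by rewrite addrC subrK.
rewrite (le_trans (ler_normD _ _))// lerD//.
have dI z : s <= z <= u -> is_derive z 1 f (df z).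
  by move=> /andP[sz zu]; apply: dfE; rewrite (lt_le_trans s0 sz) (le_lt_trans zu ud).
have [c /andP[sc cu] ->] := MVT_closed (ltW su) dI.
have c0 : 0 < c := lt_le_trans s0 sc.
rewrite normrM exprSr mulrA ler_pM//.
  rewrite (le_trans (dfb c _)) ?c0 ?(le_lt_trans cu ud)// ler_wpM2l//.
  by rewrite lerXn2r// nnegrE ltW.
by rewrite ger0_norm ?subr_ge0 ?(ltW su)// gerBl ltW.
Unshelve. all: by end_near. Qed.

(** Taylor formula in the form of a chain w 0, w 1, ..., w n of successive
    derivatives, all tending to 0 at 0: the bound e for w n is integrated n
    times. *)
Lemma littleo_of_derive_chain (n : nat) (w : nat -> R -> R) (d : R) : 0 < d ->
  (forall j u, (j < n)%N -> 0 < u < d -> is_derive u 1 (w j) (w j.+1 u)) ->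
  (forall j, (j <= n)%N -> w j u @[u --> 0^'+] --> 0) ->
  forall e, 0 < e -> exists2 r : R, 0 < r <= d &
    forall u, 0 < u < r -> `|w 0%N u| <= e * u ^+ n.
Proof.
move=> d0 dw w0 e e0.
have : \forall u \near 0^'+, `|w n u| <= e.
  move/cvgrPdist_le : (w0 n (leqnn n)) => /(_ e e0); apply: filterS => u.
  by rewrite sub0r normrN.
rewrite near_withinE => /nbhs_ballP[r0 /= r00 hr0].
pose r := Num.min d r0.
have r_gt0 : 0 < r by rewrite lt_min d0 r00.
have rd : r <= d by rewrite ge_min lexx.
have rr : r <= r0 by rewrite ge_min lexx orbT.
exists r; first by rewrite r_gt0 rd.
have step i u : (i <= n)%N -> 0 < u < r -> `|w (n - i)%N u| <= e * u ^+ i.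
  elim: i u => [|i IHi] u iN uI.
    have /andP[u0 ur] := uI; rewrite subn0 expr0 mulr1; apply: hr0 => //.
    by rewrite /ball/= sub0r normrN gtr0_norm// (lt_le_trans ur).
  have nS : (n - i = (n - i.+1).+1)%N by rewrite subnSK.
  have nlt : (n - i.+1 < n)%N by rewrite ltn_subrL (leq_ltn_trans _ iN).
  apply: (@mean_value_bound i _ (w (n - i)%N) e r) => //.
  - move=> v /andP[v0 vr]; rewrite nS; apply: dw => //.
    by rewrite v0 (lt_le_trans vr).
  - by move=> v vI; apply: IHi => //; exact: ltnW.
  - by apply: w0; exact: ltnW.
by move=> u uI; have := step n u (leqnn n) uI; rewrite subnn.
Unshelve. all: by end_near. Qed.

End taylor.

(** * The fractional initial value problem in the variable u *)

(** The normalised Riemann-Liouville integral, with the identity as order 0. *)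
Definition fracI {R : realType} (gam : R) (w : R -> R) (u : R) : R :=
  if gam == 0 then w u else RL gam w u / Gamma gam.

(** The value 1 / Gamma(1 - gamma), written through [betaR] so that the constants
    in [fracI_volterra] cancel by construction. *)
Definition frac_cst {R : realType} (gam : R) : R :=
  if gam == 0 then 1 else Gamma gam / betaR gam (1 - gam).

Section fractional.
Context {R : realType}.
Variables (gam : R) (n : nat).
Hypothesis gamI : 0 <= gam < 1.
Implicit Types (phi w : R -> R) (U u : R).

Let W := volterra (frac_cst gam) (1 - gam) n.

Let gam_pos : gam != 0 -> 0 < gam.
Proof. by move=> g0; rewrite lt0r g0; case/andP: gamI. Qed.

Let Gamma_pos : gam != 0 -> 0 < Gamma gam.
Proof.
by move=> /gam_pos g0; rewrite Gamma_gt0// g0 ltW//; case/andP: gamI.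
Qed.

Lemma onem_gam_itv : 0 < 1 - gam <= 1.
Proof. by case/andP: gamI => g0 g1; rewrite subr_gt0 g1/= gerBl. Qed.

Lemma fracI_volterra phi u : continuous phi -> fracI gam (W phi) u = iterint n.+1 phi u.
Proof.
move=> cphi; rewrite /fracI /W /volterra /frac_cst.
have [->|g0] := eqVneq gam 0.
  by rewrite mul1r subr0 /iterint iterSr.
have /andP[b0 _] := onem_gam_itv.
rewrite RL_scale ?gam_pos//; last exact: continuous_iterint_RL.
rewrite RL_iterint_RL ?gam_pos// ?subrKC//.
have B0 := betaR_gt0 (gam_pos g0) b0.
by field; rewrite !gt_eqF ?Gamma_pos.
Qed.

Lemma fracI_inj w phi U : continuous w -> continuous phi ->
  (forall u, 0 < u < U -> fracI gam w u = iterint n.+1 phi u) ->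
  forall u, 0 < u < U -> w u = W phi u.
Proof.
move=> cw cphi h; have cW : continuous (W phi).
  by apply: continuous_volterra => //; exact: onem_gam_itv.
have {}h u : 0 < u < U -> fracI gam w u = fracI gam (W phi) u.
  by move=> uI; rewrite h// fracI_volterra.
move: h; rewrite /fracI; have [_|g0] := eqVneq gam 0; first by [].
move=> h u uI; apply/eqP; rewrite -subr_eq0; apply/eqP.
have gI : 0 < gam < 1 by rewrite gam_pos//; case/andP: gamI.
apply: (@RL_inj R gam (fun v => w v - W phi v) U gI) => //.
  by move=> v; apply: (@continuous_subf R); [exact: cw|exact: cW].
move=> v vI; rewrite RL_sub ?gam_pos//; apply/eqP; rewrite subr_eq0; apply/eqP.
have := h v vI; apply: mulIf.
by rewrite invr_eq0 gt_eqF// Gamma_pos.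
Qed.

(** [RL] of order gamma multiplies a bound e v^n by at most u^gamma / gamma, and
    u^gamma <= 1 for u <= 1. *)
Lemma fracI_littleo w (d : R) : continuous w -> 0 < d ->
  (forall e, 0 < e -> exists2 r : R, 0 < r <= d &
     forall u, 0 < u < r -> `|w u| <= e * u ^+ n) ->
  forall e, 0 < e -> exists2 r : R, 0 < r <= d &
     forall u, 0 < u < r -> `|fracI gam w u| <= e * u ^+ n.
Proof.
move=> cw d0 h e e0; rewrite /fracI; have [_|g0] := eqVneq gam 0; first exact: h.
have gp := gam_pos g0; have Gp := Gamma_pos g0.
have [r /andP[r0 rd] hr] := h (e * gam * Gamma gam) ltac:(by rewrite !mulr_gt0).
exists (Num.min 1 r).
  by rewrite lt_min ltr01 r0 ge_min rd orbT.
move=> u /andP[u0]; rewrite lt_min => /andP[u1 ur].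
rewrite normrM [X in _ * X]gtr0_norm ?invr_gt0// ler_pdivrMr//.
have hb v : 0 < v < u -> `|w v| <= e * gam * Gamma gam * u ^+ n.
  move=> /andP[v0 vu]; rewrite (le_trans (hr v _)) ?v0 ?(lt_trans vu)//.
  by rewrite ler_wpM2l ?mulr_ge0 ?(ltW e0) ?(ltW gp) ?(ltW Gp)// lerXn2r// ?nnegrE ltW.
rewrite (le_trans (normr_RL gp cw hb))// ppowE ?(ltW u0)//.
have -> : e * gam * Gamma gam * u ^+ n / gam * u `^ gam =
    (e * u ^+ n * Gamma gam) * u `^ gam by field; rewrite gt_eqF.
rewrite ler_piMr ?mulr_ge0 ?exprn_ge0 ?(ltW e0) ?(ltW u0) ?(ltW Gp)//.
rewrite [leRHS](_ : 1 = 1 `^ gam); last by rewrite powR1.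
by rewrite ge0_ler_powR ?nnegrE ?ler01 ?(ltW gp) ?(ltW u0) ?(ltW u1).
Qed.

(** Here ws is the chain of derivatives of w near 0 that encodes the vanishing
    initial data, and V the chain of derivatives of [fracI gam w] on ]0, U[,
    whose last term is the right-hand side phi.  The difference of V 0 and the
    (n+1)-fold integral of phi is a polynomial of degree at most n that is
    o(u^n), hence 0. *)
Lemma fracI_initial_value w phi (ws V : nat -> R -> R) (d U : R) :
  0 < d -> 0 < U -> continuous w -> continuous phi ->
  (forall u, 0 < u < d -> w u = ws 0%N u) ->
  (forall j u, (j < n)%N -> 0 < u < d -> is_derive u 1 (ws j) (ws j.+1 u)) ->
  (forall j, (j <= n)%N -> ws j u @[u --> 0^'+] --> 0) ->
  (forall u, 0 < u < U -> V 0%N u = fracI gam w u) ->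
  (forall j u, (j < n.+1)%N -> 0 < u < U -> is_derive u 1 (V j) (V j.+1 u)) ->
  (forall u, 0 < u < U -> V n.+1 u = phi u) ->
  forall u, 0 < u < U -> w u = W phi u.
Proof.
move=> d0 U0 cw cphi wE dws ws0 VE dV Vphi; apply: fracI_inj => //.
pose E j u := V j u - iterint (n.+1 - j) phi u.
have dE j u : (j < n.+1)%N -> 0 < u < U -> is_derive u 1 (E j) (E j.+1 u).
  move=> jn uI; have /andP[u0 _] := uI.
  apply: is_derive_subf; first exact: dV.
  by rewrite subSS subSn//; exact: is_derive_iterint.
have En u : 0 < u < U -> E n.+1 u = 0 by move=> uI; rewrite /E subnn Vphi// subrr.
have [p sp Ep] := derive_chain0_poly U0 dE En.
have wo : forall e, 0 < e -> exists2 r : R, 0 < r <= d &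
    forall u, 0 < u < r -> `|w u| <= e * u ^+ n.
  move=> e e0; have [r /andP[r0 rd] hr] := littleo_of_derive_chain d0 dws ws0 e0.
  exists r; first by rewrite r0.
  by move=> u /andP[u0 ur]; rewrite wE ?hr ?u0// (lt_le_trans ur).
have [M [M0 hM]] := bounded_image_itv 0 U cphi.
have p0 : p = 0.
  apply: (poly_eq0_littleo sp) => e e0.
  have e20 : 0 < e / 2 by rewrite divr_gt0.
  have [r /andP[r0 rd] hr] := fracI_littleo cw d0 wo e20.
  have MM : 0 < e / 2 / (M + 1) by rewrite divr_gt0// ltr_wpDl.
  exists (Num.min (Num.min r U) (e / 2 / (M + 1))).
    by rewrite !lt_min r0 U0.
  move=> u /andP[u0]; rewrite !lt_min => /andP[/andP[ur uU] ue].
  have uI : 0 < u < U by rewrite u0.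
  rewrite -Ep// /E VE// subn0 (le_trans (ler_normB _ _))//.
  have -> : e * u ^+ n = e / 2 * u ^+ n + e / 2 * u ^+ n by field.
  rewrite lerD//; first by rewrite hr// u0.
  have hb v : 0 < v <= U -> `|phi v| <= M by move=> /andP[v0 vU]; rewrite hM// vU ltW.
  rewrite (le_trans (normr_iterint n.+1 cphi hb _))// ?u0 ?(ltW uU)// exprS mulrA.
  rewrite ler_wpM2r ?exprn_ge0 ?(ltW u0)//.
  rewrite (@le_trans _ _ ((M + 1) * u)) ?ler_wpM2r ?(ltW u0) ?lerDl//.
  by rewrite mulrC -ler_pdivlMr ?ltr_wpDl// ltW.
move=> u uI; rewrite -VE//; apply/eqP; rewrite -subr_eq0.
by have := Ep u uI; rewrite /E subn0 p0 horner0 => ->.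
Qed.

End fractional.

(** * The transported right-hand side *)

Lemma continuous_within_comp {R : realType} {T : topologicalType} (A : set T)
    (F : T -> R) (g : R -> T) :
  {within A, continuous F} -> continuous g -> (forall x, A (g x)) ->
  continuous (fun x => F (g x)).
Proof.
move=> /subspace_continuousP cF cg gA x.
apply: (@cvg_comp _ _ _ g F _ (within A (nbhs (g x)))); last exact: cF.
move=> P; rewrite /within /= => hP.
have : \forall y \near x, A (g y) -> P (g y) by exact: cg hP.
by apply: filterS => y; apply.
Qed.

(** Recovers the endpoints 0 and U from identities valid on the open interval. *)
Lemma eq_continuous_closed {R : realType} (F G : R -> R) (U : R) : 0 < U ->
  continuous F -> continuous G -> (forall u, 0 < u < U -> F u = G u) ->
  forall u, 0 <= u <= U -> F u = G u.
Proof.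
move=> U0 cF cG FG u /andP[u0 uU].
have [->|uN0] := eqVneq u 0.
  apply: (@cvg_unique _ (@Rhausdorff R) (F @ 0^'+)).
    by apply: cvg_at_right_filter; exact: cF.
  apply: cvg_trans (cvg_at_right_filter (cG 0)); apply: near_eq_cvg.
  by near=> v; rewrite FG//; apply/andP; split.
have [->|uNU] := eqVneq u U.
  apply: (@cvg_unique _ (@Rhausdorff R) (F @ U^'-)).
    by apply: cvg_at_left_filter; exact: cF.
  apply: cvg_trans (cvg_at_left_filter (cG U)); apply: near_eq_cvg.
  by near=> v; rewrite FG//; apply/andP; split.
by rewrite FG// !lt_neqAle u0 uU eq_sym uN0 uNU.
Unshelve. all: by end_near. Qed.

Section initial_polynomial.
Context {R : realType}.
Variables (sigma rho : R) (n : nat) (b : 'I_n.+1 -> R).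
Hypothesis rho0 : 0 < rho.

Definition initial_poly : {poly R} :=
  \poly_(k < n.+1) (b (inord k) / k`!%:R).

Lemma powR_rhoX (t : R) k : 0 <= t -> t `^ (rho * k%:R) = (t `^ rho) ^+ k.
Proof. by move=> t0; rewrite powRrM powR_mulrn// powR_ge0. Qed.

Lemma horner_initial_poly (t : R) : 0 <= t ->
  initial_poly.[t `^ rho] = \sum_(k < n.+1) b k / k`!%:R * t `^ (rho * k%:R).
Proof.
move=> t0; rewrite horner_poly; apply: eq_bigr => k _.
by rewrite inord_val powR_rhoX.
Qed.

Lemma derivn_initial_poly0 (k : 'I_n.+1) : (derivn k initial_poly).[0] = b k.
Proof.
rewrite horner_coef0 coef_derivn addn0 coef_poly ltn_ord inord_val ffactnn.
by rewrite -[LHS]mulr_natr divfK// pnatr_eq0 -lt0n fact_gt0.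
Qed.

Lemma tubeP (hstar K : R) (p : R * R) : tube sigma rho hstar K b p <->
  0 <= p.1 <= hstar /\
  `|p.2 - expR (- sigma * p.1 `^ rho) * initial_poly.[p.1 `^ rho]| <= K.
Proof.
rewrite /tube /=; split=> -[p1 h]; split=> //; move: h;
  rewrite horner_initial_poly; do ?[by case/andP: p1];
  by under eq_bigr do rewrite Gamma_nat.
Qed.

End initial_polynomial.

Section superposition.
Context {R : realType}.
Variables (sigma rho hstar K h : R) (n : nat) (b : 'I_n.+1 -> R).
Hypotheses (rho0 : 0 < rho) (h0 : 0 < h) (hh : h <= hstar).
Implicit Types (f : R * R -> R) (y z : R -> R).

Let U := h `^ rho.
Let H := tube sigma rho hstar K b.
Let T := horner (initial_poly b).

(** The right-hand side f(t, psi(t)) seen from u: pushed forward along u = t^rho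
    for psi the function with profile y, and extended from [0, U] by constants. *)
Definition superpos f y (v : R) : R :=
  let c := clamp U v in
  expR (sigma * c) * f (c `^ rho^-1, expR (- sigma * c) * y c).

(** The condition that the graph lies in [tube], transported to u; the bound
    picks up the factor e^(sigma u). *)
Definition in_tube y := continuous y /\
  forall v, 0 <= v <= U -> `|y v - T v| <= K * expR (sigma * v).

Lemma U_gt0 : 0 < U. Proof. exact: powR_gt0. Qed.

Lemma root_in (v : R) : 0 <= v <= U -> 0 <= v `^ rho^-1 <= h.
Proof.
move=> /andP[v0 vU]; rewrite powR_ge0/= -[leRHS](powR_rhoK rho0 (ltW h0)).
by rewrite ge0_ler_powR ?invr_ge0 ?nnegrE ?powR_ge0 ?(ltW rho0).
Qed.

Lemma continuous_root_clamp : continuous (fun v => (clamp U v) `^ rho^-1).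
Proof.
have -> : (fun v => (clamp U v) `^ rho^-1) = (fun v => ppow rho^-1 (clamp U v)).
  apply/funext => v; rewrite ppowE//.
  by have /andP[] := clamp_in v (ltW U_gt0).
move=> v; apply: (@continuous_compf R); first exact: continuous_clamp.
by apply: continuous_ppow; rewrite invr_gt0.
Qed.

Lemma continuous_expR_clamp (s : R) : continuous (fun v => expR (s * clamp U v)).
Proof.
move=> v; apply: (@continuous_compf R expR (fun v => s * clamp U v)).
  by apply: (@continuous_mulf R); [exact: cst_continuous|exact: continuous_clamp].
exact: continuous_expR.
Qed.

Lemma superpos_point y v : in_tube y -> 0 <= v <= U ->
  H (v `^ rho^-1, expR (- sigma * v) * y v).
Proof.
move=> [_ hy] vI; apply/tubeP; have /andP[r0 rh] := root_in vI.
have /andP[v0 _] := vI.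
split; first by rewrite /= r0 (le_trans rh).
rewrite /= powR_rhoVK// -mulrBr normrM gtr0_norm ?expR_gt0//.
by rewrite mulNr expRN mulrC ler_pdivrMr ?expR_gt0// hy.
Qed.

Lemma continuous_superpos f y : {within H, continuous f} -> in_tube y ->
  continuous (superpos f y).
Proof.
move=> cf ty; have [cy _] := ty.
move=> v; apply: (@continuous_mulf R); first exact: continuous_expR_clamp.
apply: (@continuous_within_comp R _ H f
  (fun v => ((clamp U v) `^ rho^-1, expR (- sigma * clamp U v) * y (clamp U v)))).
- by [].
- have c2 : continuous (fun v => expR (- sigma * clamp U v) * y (clamp U v)).
    move=> x; apply: (@continuous_mulf R); first exact: continuous_expR_clamp.
    by apply: (@continuous_compf R); [exact: continuous_clamp|exact: cy].
  by move=> x; exact: (cvg_pair (@continuous_root_clamp x) (c2 x)).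
- by move=> x; apply: superpos_point => //; exact/clamp_in/ltW/U_gt0.
Qed.

Lemma superposE f y v : 0 <= v <= U ->
  superpos f y v = expR (sigma * v) * f (v `^ rho^-1, expR (- sigma * v) * y v).
Proof. by move=> vI; rewrite /superpos clamp_id. Qed.

(** The two exponentials in [superpos] cancel, so f and its transport have the same
    Lipschitz constant. *)
Lemma superpos_lipschitz f (L : R) y z v : 0 <= L ->
  (forall t x x' : R, H (t, x) -> H (t, x') ->
     `|f (t, x) - f (t, x')| <= L * `|x - x'|) ->
  in_tube y -> in_tube z -> 0 <= v <= U ->
  `|superpos f y v - superpos f z v| <= L * `|y v - z v|.
Proof.
move=> L0 Lf ty tz vI; rewrite !superposE// -mulrBr normrM gtr0_norm ?expR_gt0//.
have := Lf _ _ _ (superpos_point ty vI) (superpos_point tz vI).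
rewrite -mulrBr normrM [X in L * (X * _)]gtr0_norm ?expR_gt0// => hf.
rewrite (le_trans (ler_wpM2l (expR_ge0 _) hf))// mulNr expRN.
rewrite le_eqVlt; apply/orP; left; apply/eqP; field.
by rewrite gt_eqF ?expR_gt0.
Qed.

Lemma superpos_bound f (M : R) y v : 0 <= sigma -> 0 <= M ->
  (forall p, H p -> `|f p| <= M) -> in_tube y ->
  `|superpos f y v| <= expR (sigma * U) * M.
Proof.
move=> s0 M0 fM ty; have vI := clamp_in v (ltW U_gt0).
rewrite normrM gtr0_norm ?expR_gt0// ler_pM ?expR_ge0//.
  by rewrite ler_expR ler_wpM2l//; case/andP: vI.
by apply: fM; exact: superpos_point.
Qed.

Lemma superpos_sub f1 f2 (e : R) y v : 0 <= sigma -> 0 <= e ->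
  (forall p, H p -> `|f1 p - f2 p| <= e) -> in_tube y ->
  `|superpos f1 y v - superpos f2 y v| <= expR (sigma * U) * e.
Proof.
move=> s0 e0 fe ty; have vI := clamp_in v (ltW U_gt0).
rewrite -mulrBr normrM gtr0_norm ?expR_gt0// ler_pM ?expR_ge0//.
  by rewrite ler_expR ler_wpM2l//; case/andP: vI.
by apply: fe; exact: superpos_point.
Qed.

End superposition.

(** * Solutions and fixed points *)

Section solutions.
Context {R : realType}.
Variables (sigma rho alpha hstar K h : R) (n : nat) (b : 'I_n.+1 -> R).
Hypotheses (rho0 : 0 < rho) (h0 : 0 < h) (hh : h <= hstar).
Hypothesis gamI : 0 <= n.+1%:R - alpha < 1.
Implicit Types (f : R * R -> R) (y z g w phi chi : R -> R).

Let gam := n.+1%:R - alpha.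
Let U := h `^ rho.
Let H := tube sigma rho hstar K b.
Let T := horner (initial_poly b).
Let D : set R := `]0, h].
Let W := volterra (frac_cst gam) (1 - gam) n.
Let pull := subst_pull sigma rho.
Let push := subst_push sigma rho.
Let Phi := superpos sigma rho h.
Let tubular := in_tube sigma rho K h b.

Lemma substI_fracI g w t : 0 < t -> continuous w ->
  (forall s, 0 < s <= t -> g s = pull w s) ->
  substI_exists sigma rho gam g t /\
  substI sigma rho gam g t = pull (fracI gam w) t.
Proof.
move=> t0 cw gw; rewrite /substI_exists /substI /pull /subst_pull /fracI.
have [->|g0] := eqVneq gam 0; first by split; [left|rewrite gw// t0 lexx].
have gp : 0 < gam by rewrite lt0r g0; case/andP: gamI.
have [|i1 i2] := @substI_pull R sigma rho rho0 gam g w t gp t0 cw.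
  by move=> s /andP[s0 st]; rewrite gw// s0 ltW.
split; first by right.
by rewrite mulrAC i2 mulrA.
Qed.

Lemma pull_push g t : 0 <= t -> pull (push g) t = g t.
Proof.
move=> t0; rewrite /pull /push /subst_pull /subst_push powR_rhoK// mulrA -expRD.
by rewrite mulNr addNr expR0 mul1r.
Qed.

Lemma push_pull w u : 0 <= u -> push (pull w) u = w u.
Proof.
move=> u0; rewrite /pull /push /subst_pull /subst_push powR_rhoVK// mulrA -expRD.
by rewrite mulNr addrN expR0 mul1r.
Qed.

Lemma powR_rho_itv t : 0 <= t <= h -> 0 <= t `^ rho <= U.
Proof.
by move=> /andP[t0 th]; rewrite powR_ge0/= ge0_ler_powR ?nnegrE ?(ltW rho0) ?(ltW h0).
Qed.

Lemma continuous_T : continuous T.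
Proof. exact: continuous_horner. Qed.

Lemma continuous_W phi : continuous phi -> continuous (W phi).
Proof. by apply: continuous_volterra; exact: onem_gam_itv. Qed.

Lemma caputo_argE chi t : 0 <= t ->
  (forall k : 'I_n.+1, substD_at0 D sigma rho k chi = b k) ->
  caputo_arg D sigma rho n.+1 chi t = chi t - pull T t.
Proof.
move=> t0 hb; rewrite /caputo_arg /pull /subst_pull /T horner_initial_poly//.
congr (_ - _); rewrite mulr_sumr; apply: eq_bigr => k _.
by rewrite hb mulrC.
Qed.

Definition fixpoint_of f y := tubular y /\
  forall u, 0 <= u <= U -> y u = T u + W (Phi f y) u.

(** For a fixed point y this is [pull y] on [0, h], but written through the
    right-hand side of the fixed point equation: it then equals an explicit
    chain of iterated integrals for every t > 0, also beyond h. *)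
Definition solution_of f y (t : R) : R :=
  pull (fun u => T u + W (Phi f y) u) t.

Lemma solution_of_fixpoint f y : fixpoint_of f y ->
  forall t, 0 <= t <= h -> solution_of f y t = pull y t.
Proof.
move=> [_ yE] t tI; rewrite /solution_of /pull /subst_pull.
by rewrite -yE// powR_rho_itv.
Qed.

Lemma within_continuous_pull Z : continuous Z -> {within `[0, h], continuous (pull Z)}.
Proof.
move=> cZ; apply: (@subspace_eq_continuous _ _ _ (fun t => expR (- sigma * ppow rho t) * Z (ppow rho t))).
  by move=> t; rewrite inE/= in_itv/= => /andP[t0 _]; rewrite /pull /subst_pull /= ppowE.
apply: continuous_subspaceT => t; apply: (@continuous_mulf R).
  apply: (@continuous_compf R expR (fun t => - sigma * ppow rho t)); last exact: continuous_expR.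
  by apply: (@continuous_mulf R); [exact: cst_continuous|exact: continuous_ppow].
by apply: (@continuous_compf R); [exact: continuous_ppow|exact: cZ].
Qed.

Lemma cvg_pull_at0 Z : continuous Z -> pull Z t @[t --> 0^'+] --> Z 0.
Proof.
move=> cZ.
have c : continuous (fun t => expR (- sigma * ppow rho t) * Z (ppow rho t)).
  move=> t; apply: (@continuous_mulf R).
    apply: (@continuous_compf R expR (fun t => - sigma * ppow rho t)); last exact: continuous_expR.
    by apply: (@continuous_mulf R); [exact: cst_continuous|exact: continuous_ppow].
  by apply: (@continuous_compf R); [exact: continuous_ppow|exact: cZ].
have := cvg_at_right_filter (c 0).
rewrite ppow_le0// mulr0 expR0 mul1r; apply: cvg_trans; apply: near_eq_cvg.
by near=> t; rewrite /pull /subst_pull ppowE.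
Unshelve. all: by end_near. Qed.

(** Both sides of the problem are computed by [substD_pull_chain]: once for psi,
    along the chain Z of its derivatives up to order n, and once for the
    fractional integral of psi minus its initial polynomial, along the chain V
    of iterated integrals of the right-hand side. *)
Lemma solution_on_of_fixpoint f y : {within H, continuous f} -> fixpoint_of f y ->
  solution_on sigma rho alpha b H f h (solution_of f y).
Proof.
move=> cf fy; have [ty yE] := fy; have solE := solution_of_fixpoint fy.
set psi := solution_of f y.
have cphi : continuous (Phi f y) by exact: (@continuous_superpos R sigma rho hstar K h n b).
have onI := onem_gam_itv gamI; have /andP[on0 _] := onI.
pose Z j u := (derivn j (initial_poly b)).[u] +
  frac_cst gam * iterint (n - j) (RL (1 - gam) (Phi f y)) u.
have cZ j : continuous (Z j).
  move=> u; apply: (@continuous_addf R); first exact: continuous_horner.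
  apply: (@continuous_mulf R); first exact: cst_continuous.
  exact: continuous_iterint_RL.
have dZ j (u : R) : (j < n)%N -> 0 < u -> is_derive u 1 (Z j) (Z j.+1 u).
  move=> jn u0.
  have d1 : is_derive u 1 (horner (derivn j (initial_poly b)))
      (derivn j.+1 (initial_poly b)).[u].
    by rewrite derivnS; exact: is_derive_horner.
  have d2 : is_derive u 1 (iterint (n - j) (RL (1 - gam) (Phi f y)))
      (iterint (n - j.+1) (RL (1 - gam) (Phi f y)) u).
    by rewrite -subnSK//; apply: is_derive_iterint => //; exact: continuous_RL.
  exact: (is_derive_addf d1 (is_derive_scalef _ d2)).
have Z0 s : 0 < s <= h -> psi s = pull (Z 0%N) s.
  by move=> _; rewrite /psi /solution_of /pull /subst_pull /Z subn0.
have [SZ exZ] := @substD_pull_chain R sigma rho h rho0 n psi Z Z0 dZ.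
have nearI : \forall t \near 0^'+, 0 < t <= h.
  by near=> t; apply/andP; split; near: t; [exact: nbhs_right_gt|exact: nbhs_right_le].
have cvgk k : (k <= n)%N -> substD D sigma rho k psi t @[t --> 0^'+] --> Z k 0.
  move=> kn; apply: cvg_trans (cvg_pull_at0 (cZ k)); apply: near_eq_cvg.
  by apply: filterS nearI => t tI; rewrite SZ.
have Zk0 (k : 'I_n.+1) : Z k 0 = b k.
  rewrite /Z derivn_initial_poly0; have kn : (k <= n)%N by rewrite -ltnS.
  case: (n - k)%N => [|i] /=; rewrite RL_le0 ?mulr0 ?addr0//.
have at0 (k : 'I_n.+1) : substD_at0 D sigma rho k psi = b k.
  rewrite -Zk0; apply: cvg_lim; first exact: Rhausdorff.
  by apply: cvgk; rewrite -ltnS.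
pose V j u := iterint (n.+1 - j) (Phi f y) u.
have dV j (u : R) : (j < n.+1)%N -> 0 < u -> is_derive u 1 (V j) (V j.+1 u).
  by move=> jn u0; rewrite /V -subnSK//; exact: is_derive_iterint.
have argE s : 0 < s -> caputo_arg D sigma rho n.+1 psi s = pull (W (Phi f y)) s.
  move=> s0; rewrite caputo_argE ?(ltW s0)// /psi /solution_of /pull /subst_pull.
  by rewrite mulrDr addrC addKr.
have sI t : 0 < t -> substI_exists sigma rho gam (caputo_arg D sigma rho n.+1 psi) t /\
    substI sigma rho gam (caputo_arg D sigma rho n.+1 psi) t = pull (V 0%N) t.
  move=> t0; have [||e1 e2] := @substI_fracI (caputo_arg D sigma rho n.+1 psi) (W (Phi f y)) t t0.
  - exact: continuous_W.
  - by move=> s /andP[s0 _]; exact: argE.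
  split=> //; rewrite e2 /pull /subst_pull /V subn0 /W.
  by rewrite (fracI_volterra n gamI).
have [SV exV] := @substD_pull_chain R sigma rho h rho0 n.+1
  (substI sigma rho gam (caputo_arg D sigma rho n.+1 psi)) V
  (fun s sI' => (sI s (proj1 (andP sI'))).2) dV.
split.
- exact: within_continuous_pull (fun u => continuous_addf (@continuous_T u) (@continuous_W _ cphi u)).
- move=> t tI; have /andP[t0 th] := tI; rewrite /psi solE//.
  have := superpos_point rho0 h0 hh ty (powR_rho_itv tI).
  by rewrite powR_rhoK.
- split.
  + move=> k kn; split.
      apply: filterS nearI => t tI j jk; apply: exZ => //.
      by rewrite (leq_trans jk)// -ltnS.
    by apply/cvg_ex; exists (Z k 0); apply: cvgk; rewrite -ltnS.
  + by move=> t; rewrite /D/= in_itv/= => /andP[t0 _]; exact: (sI t t0).1.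
  + by move=> t; rewrite /D/= in_itv/=; exact: exV.
- move=> t tI; have /andP[t0 th] := tI.
  have tI0 : 0 <= t <= h by rewrite ltW.
  rewrite /caputoD /substDfrac SV// /pull /subst_pull /V subnn /=.
  rewrite /Phi superposE ?powR_rho_itv// powR_rhoK ?(ltW t0)// mulrA -expRD mulNr addNr expR0 mul1r.
  by rewrite /psi solE// /pull /subst_pull mulNr.
- exact: at0.
Unshelve. all: by end_near. Qed.

(** The function of u that corresponds to chi, extended from [0, U] by constants
    in order to be globally continuous. *)
Definition profile chi (u : R) : R :=
  expR (sigma * clamp U u) * chi ((clamp U u) `^ rho^-1).

Lemma profileE chi u : 0 <= u <= U -> profile chi u = push chi u.
Proof. by move=> uI; rewrite /profile clamp_id. Qed.

Lemma pull_profile chi t : 0 <= t <= h -> pull (profile chi) t = chi t.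
Proof.
move=> tI; have /andP[t0 _] := tI.
by rewrite -[RHS]pull_push// /pull /subst_pull profileE// powR_rho_itv.
Qed.

Lemma continuous_profile chi : {within `[0, h], continuous chi} ->
  continuous (profile chi).
Proof.
move=> cchi u; apply: (@continuous_mulf R).
  exact: (@continuous_expR_clamp R rho h).
apply: (@continuous_within_comp R _ `[0, h] chi (fun v => (clamp U v) `^ rho^-1)) => //.
  exact: (@continuous_root_clamp R rho h rho0 h0).
move=> v; rewrite /= in_itv/=; apply: (root_in rho0 h0).
exact/clamp_in/ltW/powR_gt0.
Qed.

Lemma cvg_root_at0 : u `^ rho^-1 @[u --> 0^'+] --> 0^'+.
Proof.
have r0 : 0 < rho^-1 by rewrite invr_gt0.
move=> P hP; have := powR_cvg0 r0 => hc.
have {}hP : \forall x \near (0 : R), 0 < x -> P x by exact: hP.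
have := hc _ hP; rewrite /nbhs/= => hN.
have g0 : \forall u \near (0 : R)^'+, 0 < u by exact: nbhs_right_gt.
apply: filterS2 hN g0 => u hu u0.
by apply: hu; rewrite powR_gt0.
Qed.

(** [fracI_initial_value] applies to w = y - T.  Its chain near 0 comes from the
    existence of the derivatives of chi on some ]0, e[ and their limits b_k,
    its chain on ]0, U[ from the existence of the fractional derivative. *)
Lemma fixpoint_of_solution_on f chi : {within H, continuous f} ->
  solution_on sigma rho alpha b H f h chi -> fixpoint_of f (profile chi).
Proof.
move=> cf [cchi Hchi [ex0 exI exD] eqchi at0].
have U0 : 0 < U by exact: powR_gt0.
set y := profile chi.
have cy : continuous y by exact: continuous_profile.
have ty : tubular y.
  split=> // v vI; rewrite /y profileE//.
  have := Hchi _ (root_in rho0 h0 vI) => /tubeP[_ /=].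
  rewrite powR_rhoVK//; last by case/andP: vI.
  rewrite mulNr expRN => hK.
  have -> : push chi v - (initial_poly b).[v] = expR (sigma * v) *
      (chi (v `^ rho^-1) - (expR (sigma * v))^-1 * (initial_poly b).[v]).
    by rewrite /push /subst_push; field; rewrite gt_eqF ?expR_gt0.
  by rewrite normrM gtr0_norm ?expR_gt0// mulrC ler_wpM2r ?expR_ge0.
split=> //.
have cphi : continuous (Phi f y) by exact: (@continuous_superpos R sigma rho hstar K h n b).
pose w u := y u - T u.
have cw : continuous w.
  by move=> u; apply: (@continuous_subf R); [exact: cy|exact: continuous_T].
have argE s : 0 < s <= h -> caputo_arg D sigma rho n.+1 chi s = pull w s.
  move=> /andP[s0 sh]; rewrite caputo_argE ?(ltW s0)//.
  rewrite -[X in X - _ = _]pull_profile ?(ltW s0)// /pull /subst_pull -mulrBr.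
  by [].
have sI t : 0 < t <= h ->
    substI sigma rho gam (caputo_arg D sigma rho n.+1 chi) t = pull (fracI gam w) t.
  move=> /andP[t0 th].
  have [||_ ->//] := @substI_fracI (caputo_arg D sigma rho n.+1 chi) w t t0 => //.
  by move=> s /andP[s0 st]; rewrite argE// s0 (le_trans st).
pose J := substI sigma rho gam (caputo_arg D sigma rho n.+1 chi).
pose V j := push (substD D sigma rho j J).
have [near_ex _] := ex0 n (leqnn _).
have [e /andP[e0 eh] ex_e] : exists2 e : R, 0 < e <= h &
    forall t, 0 < t < e -> substD_exists D sigma rho n chi t.
  move: near_ex; rewrite near_withinE => /nbhs_ballP[r /= r0 hr].
  exists (Num.min r h); first by rewrite lt_min r0 h0 ge_min lexx orbT.
  move=> t /andP[t0]; rewrite lt_min => /andP[tr _]; apply: hr => //.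
  by rewrite /ball/= sub0r normrN gtr0_norm.
pose d := e `^ rho.
have d0 : 0 < d by exact: powR_gt0.
have dU : d <= U by rewrite ge0_ler_powR ?nnegrE ?(ltW rho0) ?(ltW h0) ?(ltW e0).
pose ws j u := push (substD D sigma rho j chi) u - (derivn j (initial_poly b)).[u].
have dws j (u : R) : (j < n)%N -> 0 < u < d -> is_derive u 1 (ws j) (ws j.+1 u).
  move=> jn uI.
  have d1 : is_derive u 1 (horner (derivn j (initial_poly b)))
      (derivn j.+1 (initial_poly b)).[u].
    by rewrite derivnS; exact: is_derive_horner.
  have eI : 0 < e <= h by rewrite e0.
  have d2 := @push_chain R sigma rho h rho0 n chi e eI ex_e j u jn uI.
  exact: (is_derive_subf d2 d1).
have ws0 j : (j <= n)%N -> ws j u @[u --> 0^'+] --> 0.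
  move=> jn; have jn' : (j < n.+1)%N by rewrite ltnS.
  pose jo := Ordinal jn'.
  have [_ hc] := ex0 j jn'.
  have {}hc : substD D sigma rho j chi t @[t --> 0^'+] --> b jo.
    by rewrite -(at0 jo).
  have h1 : push (substD D sigma rho j chi) u @[u --> 0^'+] --> b jo.
    rewrite -[b jo]mul1r; apply: cvgM; last first.
      by apply: (@cvg_comp _ _ _ _ (substD D sigma rho j chi) _ 0^'+) hc; exact: cvg_root_at0.
    rewrite -[X in _ --> X]expR0 -[X in expR X](mulr0 sigma).
    apply: (@cvg_at_right_filter _ _ (fun u : R => expR (sigma * u))).
    apply: (@continuous_compf R expR (fun u => sigma * u)); last exact: continuous_expR.
    by apply: (@continuous_mulf R); [exact: cst_continuous|exact: continuous_id].
  have h2 : (derivn j (initial_poly b)).[u] @[u --> 0^'+] --> b jo.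
    rewrite -(derivn_initial_poly0 b jo).
    by apply: cvg_at_right_filter; exact: (@continuous_horner R _ 0).
  by rewrite -[X in _ --> X](subrr (b jo)); exact: (cvgB h1 h2).
have wE u : 0 < u < d -> w u = ws 0%N u.
  move=> /andP[u0 ud]; rewrite /w /ws /y profileE//.
  by rewrite ltW//= (le_trans (ltW ud)).
have tI u : 0 < u < U -> 0 < u `^ rho^-1 <= h.
  move=> /andP[u0 uU]; rewrite powR_gt0//=.
  have uI : 0 <= u <= U by rewrite !ltW.
  by have /andP[] := root_in rho0 h0 uI.
have VE u : 0 < u < U -> V 0%N u = fracI gam w u.
  move=> uI; have /andP[u0 _] := uI.
  rewrite -[RHS]push_pull ?(ltW u0)// /V /push /subst_push /=.
  by rewrite -sI ?tI.
have dV j (u : R) : (j < n.+1)%N -> 0 < u < U -> is_derive u 1 (V j) (V j.+1 u).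
  move=> jn uI; have hI : 0 < h <= h by rewrite h0 lexx.
  apply: (@push_chain R sigma rho h rho0 n.+1 J h hI _ j u jn uI) => t /andP[t0 th].
  by apply: exD; rewrite /= in_itv/= t0 ltW.
have Vphi u : 0 < u < U -> V n.+1 u = Phi f y u.
  move=> uI; have /andP[u0 uU] := uI.
  have uI' : 0 <= u <= U by rewrite !ltW.
  rewrite /V /push /subst_push.
  have := eqchi _ (tI u uI); rewrite /caputoD /substDfrac => ->.
  rewrite /Phi superposE// /y profileE// /push /subst_push mulrA -expRD.
  by rewrite mulNr addNr expR0 mul1r.
have := @fracI_initial_value R gam n gamI w (Phi f y) ws V d U d0 U0 cw cphi
  wE dws ws0 VE dV Vphi => hw.
apply: eq_continuous_closed => //.
  by move=> u; apply: (@continuous_addf R); [exact: continuous_T|exact: continuous_W].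
by move=> u uI; rewrite -[W _ _]hw// /w addrC subrK.
Qed.

(** The condition U <= 1 lets the powers of u produced by the n integrations be
    bounded by 1. *)
Lemma normr_volterra_le phi (M u : R) : U <= 1 -> continuous phi ->
  (forall v, `|phi v| <= M) -> 0 <= u <= U ->
  `|W phi u| <= `|frac_cst gam| * (M / (1 - gam) * U `^ (1 - gam)).
Proof.
move=> U1 cphi hM /andP[u0 uU]; have /andP[b0 b1] := onem_gam_itv gamI.
have U0 : 0 < U by exact: powR_gt0.
have M0 : 0 <= M by apply: le_trans (hM 0).
have B0 : 0 <= M / (1 - gam) * U `^ (1 - gam).
  by rewrite mulr_ge0 ?powR_ge0// divr_ge0// ltW.
rewrite /W /volterra normrM ler_wpM2l//.
have [->|uN0] := eqVneq u 0.
  by case: n => [|i] /=; rewrite RL_le0 ?normr0//.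
have {}u0 : 0 < u by rewrite lt_neqAle eq_sym uN0.
have hb v : 0 < v <= U -> `|RL (1 - gam) phi v| <= M / (1 - gam) * U `^ (1 - gam).
  move=> /andP[v0 vU]; rewrite (le_trans (normr_RL b0 cphi (fun v _ => hM v)))//.
  rewrite ler_wpM2l ?divr_ge0 ?(ltW b0)// ppowE ?(ltW v0)//.
  by rewrite ge0_ler_powR ?nnegrE ?(ltW b0) ?(ltW v0) ?(ltW U0).
rewrite (le_trans (normr_iterint n (continuous_RL b0 cphi) hb _)) ?u0//.
by rewrite ler_piMr// exprn_ile1 ?(ltW u0)// (le_trans uU).
Qed.

Lemma exists_fixpoint f (M L : R) : 0 <= sigma -> 0 < K -> U <= 1 ->
  {within H, continuous f} -> 0 <= M -> (forall p, H p -> `|f p| <= M) ->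
  0 < L -> (forall t x x' : R, H (t, x) -> H (t, x') ->
     `|f (t, x) - f (t, x')| <= L * `|x - x'|) ->
  `|frac_cst gam| * (expR sigma * M / (1 - gam) * U `^ (1 - gam)) <= K ->
  exists y, fixpoint_of f y.
Proof.
move=> s0 K0 U1 cf M0 fM L0 fL hK.
have U0 : 0 < U by exact: powR_gt0.
have cS y : tubular y -> continuous (Phi f y).
  by move=> ty; exact: (@continuous_superpos R sigma rho hstar K h n b).
have := @volterra_fixpoint R (frac_cst gam) (1 - gam) U n (onem_gam_itv gamI) U0
  T (fun v => K * expR (sigma * v)) (Phi f) L.
case=> //.
- exact: continuous_T.
- by move=> v; rewrite mulr_ge0 ?expR_ge0// ltW.
- by move=> y z ty tz v; apply: (superpos_lipschitz rho0 h0 hh (ltW L0) fL).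
- move=> y ty u uI.
  have /andP[u0 _] := uI.
  have hb v : `|Phi f y v| <= expR (sigma * U) * M.
    by apply: (@superpos_bound _ sigma rho hstar K h n b rho0 h0 hh f M y v s0 M0 fM); case: ty.
  apply: (le_trans (normr_volterra_le U1 (cS y ty) hb uI)).
  apply: (@le_trans _ _ K); last first.
    by rewrite ler_peMr ?(ltW K0)// -[leLHS]expR0 ler_expR mulr_ge0.
  apply: le_trans hK; have /andP[b0 _] := onem_gam_itv gamI.
  rewrite ler_wpM2l// ler_wpM2r ?powR_ge0// ler_wpM2r ?invr_ge0 ?(ltW b0)//.
  by rewrite ler_wpM2r// ler_expR ler_piMr.
- by move=> y ty yE; exists y.
Qed.

(** Two fixed points for the same right-hand side agree, by stability with
    perturbation 0. *)
Lemma unique_solution_of_fixpoint f y (L : R) :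
  {within H, continuous f} ->
  0 < L -> (forall t x x' : R, H (t, x) -> H (t, x') ->
     `|f (t, x) - f (t, x')| <= L * `|x - x'|) ->
  fixpoint_of f y ->
  unique_solution_on sigma rho alpha b H f h (solution_of f y).
Proof.
move=> cf L0 fL fy; split; first exact: solution_on_of_fixpoint.
move=> chi schi t tI; rewrite solution_of_fixpoint//.
have fchi := fixpoint_of_solution_on cf schi.
rewrite -[LHS](pull_profile _ tI) /pull /subst_pull; congr (_ * _).
have U0 : 0 < U by exact: powR_gt0.
have [C C0 hC] := volterra_stability (frac_cst gam) n (onem_gam_itv gamI) U0 L0.
have [ty yE] := fy; have [tc cE] := fchi.
have := hC T (profile chi) y (Phi f (profile chi)) (Phi f y) 0 tc.1 ty.1.
move=> /(_ _ _ (lexx 0) cE yE _ _ (powR_rho_itv tI)).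
rewrite mulr0 normr_le0 subr_eq0 => H0; apply/eqP/H0.
- exact: (@continuous_superpos R sigma rho hstar K h n b).
- exact: (@continuous_superpos R sigma rho hstar K h n b).
- move=> u uI; rewrite addr0.
  exact: (superpos_lipschitz rho0 h0 hh (ltW L0) fL).
Qed.

(** With F1 and F2 the transports of f1 and f2, F1 y1 - F2 y2
    = (F1 y1 - F1 y2) + (F1 y2 - F2 y2), so only f1 has to be
    Lipschitz and C does not depend on f2. *)
Lemma fixpoint_perturbation (L : R) : 0 <= sigma -> 0 < L ->
  exists2 C : R, 0 < C & forall f1 f2 y1 y2 (e : R), 0 <= e ->
    {within H, continuous f1} -> {within H, continuous f2} ->
    (forall t x x' : R, H (t, x) -> H (t, x') ->
       `|f1 (t, x) - f1 (t, x')| <= L * `|x - x'|) ->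
    (forall p, H p -> `|f1 p - f2 p| <= e) ->
    fixpoint_of f1 y1 -> fixpoint_of f2 y2 ->
    forall t, 0 <= t <= h -> `|solution_of f1 y1 t - solution_of f2 y2 t| <= C * e.
Proof.
move=> s0 L0; have U0 : 0 < U by exact: powR_gt0.
have [C C0 hC] := volterra_stability (frac_cst gam) n (onem_gam_itv gamI) U0 L0.
exists (C * expR (sigma * U)); first by rewrite mulr_gt0 ?expR_gt0.
move=> f1 f2 y1 y2 e e0 cf1 cf2 fL fe fy1 fy2 t tI.
rewrite !solution_of_fixpoint// /pull /subst_pull -mulrBr normrM gtr0_norm ?expR_gt0//.
have [t1 E1] := fy1; have [t2 E2] := fy2.
apply: (@le_trans _ _ `|y1 (t `^ rho) - y2 (t `^ rho)|).
  rewrite ler_piMl// -[leRHS]expR0 ler_expR mulNr oppr_le0 mulr_ge0//.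
  exact: powR_ge0.
rewrite -mulrA.
apply: (hC T y1 y2 (Phi f1 y1) (Phi f2 y2) _ t1.1 t2.1) => //.
- exact: (@continuous_superpos R sigma rho hstar K h n b).
- exact: (@continuous_superpos R sigma rho hstar K h n b).
- by rewrite mulr_ge0 ?expR_ge0.
- move=> u uI.
  have -> : Phi f1 y1 u - Phi f2 y2 u =
    (Phi f1 y1 u - Phi f1 y2 u) + (Phi f1 y2 u - Phi f2 y2 u) by ring.
  rewrite (le_trans (ler_normD _ _))// lerD//.
    exact: (superpos_lipschitz rho0 h0 hh (ltW L0) fL).
  by apply: (@superpos_sub _ sigma rho hstar K h n b rho0 h0 hh f1 f2 e y2 u s0 e0 fe); case: t2.
- exact: powR_rho_itv.
Qed.

End solutions.

Theorem theorem13 (R : realType) (sigma rho alpha K hstar : R) (m : nat)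
    (b : 'I_m -> R) (f : R * R -> R)
    (sigma_gt0 : 0 < sigma) (rho_gt0 : 0 < rho) (alpha_gt0 : 0 < alpha)
    (m_ceil : m%:Z = Num.ceil alpha) (K_gt0 : 0 < K) (hstar_gt0 : 0 < hstar)
    (f_adm : admissible (tube sigma rho hstar K b) f) :
  exists eps0 h C : R,
    [/\ 0 < eps0, 0 < h, 0 < C
      & forall ftilde : R * R -> R,
          admissible (tube sigma rho hstar K b) ftilde ->
        forall eps : R,
          is_max [set `|f p - ftilde p| | p in tube sigma rho hstar K b] eps ->
          eps <= eps0 ->
        exists psi phi : R -> R,
          [/\ unique_solution_on sigma rho alpha b (tube sigma rho hstar K b)
                f h psi,
              unique_solution_on sigma rho alpha b (tube sigma rho hstar K b)
                ftilde h phi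
            & (ereal_sup [set (`|psi t - phi t|)%:E | t in `[0%R, h]]
                <= (C * eps)%:E)%E ]].
Proof.
have /andP[cl cr] := ceil_itv alpha.
have mI : m%:R - 1 < alpha <= m%:R.
  by move: cl cr; rewrite -m_ceil intrB -pmulrn => -> ->.
case: m b f_adm mI {m_ceil cl cr} => [|n] b f_adm /andP[ml mr].
  by move: mr; rewrite leNgt alpha_gt0.
have gamI : 0 <= n.+1%:R - alpha < 1 by rewrite subr_ge0 mr/=; lra.
set gam := n.+1%:R - alpha in gamI.
have /andP[b0 b1] := onem_gam_itv gamI.
have [cf [M0 [_ fbnd]] [L L0 fL]] := f_adm.
pose M := `|M0| + 1.
have M_ge0 : 0 <= M by rewrite addr_ge0.
have fM p : tube sigma rho hstar K b p -> `|f p| <= M.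
  by apply: fbnd; rewrite (le_lt_trans (ler_norm _))// ltrDl.
(* M + 1 bounds f and every ftilde with eps <= 1.  Then B * h ^ (rho (1 - gam))
   bounds the integral term of the Volterra equation, and h is chosen to make
   this at most K. *)
pose B := `|frac_cst gam| * (expR sigma * (M + 1) / (1 - gam)).
have B_ge0 : 0 <= B.
  by rewrite mulr_ge0// divr_ge0 ?(ltW b0)// mulr_ge0 ?expR_ge0// addr_ge0.
have KB : 0 < K / (B + 1) by rewrite divr_gt0// ltr_wpDl.
pose U0 := Num.min 1 ((K / (B + 1)) `^ (1 - gam)^-1).
have U00 : 0 < U0 by rewrite lt_min ltr01 powR_gt0.
pose h := Num.min hstar (U0 `^ rho^-1).
have h0 : 0 < h by rewrite lt_min hstar_gt0 powR_gt0.
have hh : h <= hstar by rewrite ge_min lexx.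
have UU0 : h `^ rho <= U0.
  rewrite -[leRHS](powR_rhoVK rho_gt0 (ltW U00)).
  by rewrite ge0_ler_powR ?nnegrE ?powR_ge0 ?(ltW rho_gt0) ?(ltW h0)// ge_min lexx orbT.
have U1 : h `^ rho <= 1 by rewrite (le_trans UU0)// ge_min lexx.
have hK : `|frac_cst gam| * (expR sigma * (M + 1) / (1 - gam) * (h `^ rho) `^ (1 - gam)) <= K.
  rewrite mulrA -/B.
  have : (h `^ rho) `^ (1 - gam) <= K / (B + 1).
    rewrite -[leRHS](powR_rhoVK b0 (ltW KB)).
    rewrite ge0_ler_powR ?nnegrE ?powR_ge0 ?(ltW b0)//.
    by rewrite (le_trans UU0)// ge_min lexx orbT.
  rewrite ler_pdivlMr ?ltr_wpDl// => hKB; apply: le_trans hKB.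
  by rewrite mulrC ler_wpM2l ?powR_ge0// lerDl.
have [C C0 hC] := fixpoint_perturbation K b rho_gt0 h0 hh gamI (ltW sigma_gt0) L0.
exists 1, h, C; split=> // ft [cft _ [L' L'0 ftL]] eps [[p0 _ peps] epsub] eps1.
have eps0 : 0 <= eps by rewrite -peps.
have fe p : tube sigma rho hstar K b p -> `|f p - ft p| <= eps.
  by move=> Hp; apply: epsub; exists p.
have fM1 p : tube sigma rho hstar K b p -> `|f p| <= M + 1.
  by move=> /fM hp; rewrite (le_trans hp)// lerDl.
have ftM1 p : tube sigma rho hstar K b p -> `|ft p| <= M + 1.
  move=> Hp; have -> : ft p = f p - (f p - ft p) by ring.
  rewrite (le_trans (ler_normB _ _))// lerD ?fM//.
  by rewrite (le_trans (fe p Hp)).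
have M1_ge0 : 0 <= M + 1 by rewrite addr_ge0.
have [y1 fy1] := exists_fixpoint rho_gt0 h0 hh gamI (ltW sigma_gt0) K_gt0 U1 cf
  M1_ge0 fM1 L0 fL hK.
have [y2 fy2] := exists_fixpoint rho_gt0 h0 hh gamI (ltW sigma_gt0) K_gt0 U1 cft
  M1_ge0 ftM1 L'0 ftL hK.
exists (solution_of sigma rho alpha h b f y1), (solution_of sigma rho alpha h b ft y2).
split.
- exact: (unique_solution_of_fixpoint rho_gt0 h0 hh gamI cf L0 fL fy1).
- exact: (unique_solution_of_fixpoint rho_gt0 h0 hh gamI cft L'0 ftL fy2).
- apply: ge_ereal_sup => _ [t tI <-]; rewrite lee_fin.
  exact: (hC f ft y1 y2 eps).
Qed.
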